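(* Let $(M,g)$ be a closed Riemannian manifold and let $f=f_1+if_2:M\to\mathbb{C}$ be a $(\lambda,\mu)$-eigenfunction, where $f_1,f_2:M\to\mathbb{R}$ are its real and imaginary parts. (1) Let $a,b\in\mathbb{N}$ be not both even. Then $$\int_M f_1^a f_2^b\,dV_g=0,$$ where $dV_g$ denotes the Riemannian volume form of $(M,g)$. (2) Let $a,b\in\mathbb{N}$. Then $$\int_M f_1^{2a}f_2^{2b}\,dV_g=\frac{\binom{a+b}{a}}{\binom{2a+2b}{2a}}\int_M f_1^{2a+2b}\,dV_g.$$
   Context: Closed means compact without boundary; $\mathbb{N}=\{0,1,2,\dots\}$. $\Delta=\operatorname{div}\nabla$ is the Laplace-Beltrami operator, extended complex-linearly; $g$ is extended complex-bilinearly to $T^{\mathbb{C}}M$ and $\kappa(\varphi,\psi)=g(\nabla\varphi,\nabla\psi)$. A smooth $f:M\to\mathbb{C}$ is a $(\lambda,\mu)$-eigenfunction ($\lambda,\mu\in\mathbb{C}$) if $\Delta f=\lambda f$ and $\kappa(f,f)=\mu f^2$.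
   Formalization: The formal theorem also assumes that f is identically zero or not locally constant (for connected M: f = 0 or f nonconstant), since nonzero constants such as f = 1 are (0,0)-eigenfunctions that violate the claim. *)

(* Defs.v *)
From HB Require Import structures.
From mathcomp Require Import all_boot all_order all_algebra.
From mathcomp Require Import all_classical all_reals all_analysis.
From mathcomp Require Export complex.

Set Implicit Arguments.
Unset Strict Implicit.
Unset Printing Implicit Defensive.
Import Order.TTheory GRing.Theory Num.Theory.
Import numFieldNormedType.Exports.
Local Open Scope classical_set_scope.
Local Open Scope ring_scope.

Section euclidean.
Context {R : realType}.

Definition partial n (k : 'I_n) (h : 'rV[R]_n -> R) : 'rV[R]_n -> R :=
  fun x => 'D_(delta_mx 0 k) h x.

Definition partials n (s : seq 'I_n) (h : 'rV[R]_n -> R) : 'rV[R]_n -> R :=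
  foldr (@partial n) h s.

(* C^oo on U; meant for open U only, where the values of h outside U are
   irrelevant. *)
Definition smooth_on n (U : set 'rV[R]_n) (h : 'rV[R]_n -> R) : Prop :=
  forall s : seq 'I_n,
    {in U, continuous (partials s h)} /\
    (forall x k, U x -> derivable (partials s h) x (delta_mx 0 k)).

(* Integration against the n-dimensional Lebesgue measure, written as an
   iterated integral; by Tonelli this is the usual integral for nonnegative
   Borel integrands, and it is applied only to those. *)
Fixpoint lebesgue_nint n : ('rV[R]_n -> \bar R) -> \bar R :=
  match n with
  | 0 => fun h => h 0
  | m.+1 => fun h =>
      (\int[@lebesgue_measure R]_t
         lebesgue_nint (fun y : 'rV[R]_m => h (row_mx (t%:M : 'rV_1) y)))%E
  end.

End euclidean.

(* A smooth n-manifold without boundary, given by an atlas: each chart i is a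
   homeomorphism phi i, with inverse psi i, from the open set dom i onto an
   open subset of R^n. The values of phi i outside dom i and of psi i outside
   the image are junk. *)
Record smooth_atlas (R : realType) (n : nat) (M : topologicalType) := {
  chart : Type;
  dom : chart -> set M;
  phi : chart -> M -> 'rV[R]_n;
  psi : chart -> 'rV[R]_n -> M;
  cod := fun i => phi i @` dom i;
  dom_open : forall i, open (dom i);
  cod_open : forall i, open (cod i);
  dom_cover : forall p, exists i, dom i p;
  phiK : forall i, {in dom i, cancel (phi i) (psi i)};
  phi_continuous : forall i, {in dom i, continuous (phi i)};
  psi_continuous : forall i, {in cod i, continuous (psi i)};
  transition_smooth : forall i j (k : 'I_n),
    smooth_on (phi i @` (dom i `&` dom j)) (fun x => phi j (psi i x) 0 k) }.

(* A Riemannian metric, given by its Gram matrices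
   (gram i x) k l = g(d/dx_k, d/dx_l) in the coordinates of each chart i.
   The library's Jacobian acts on row vectors, i.e. its (k, l) entry is the
   k-th partial derivative of the l-th component. *)
Record riemannian_metric (R : realType) (n : nat) (M : topologicalType)
    (A : smooth_atlas R n M) := {
  gram : chart A -> 'rV[R]_n -> 'M[R]_n;
  gram_smooth : forall i (k l : 'I_n),
    smooth_on (cod i) (fun x => gram i x k l);
  gram_sym : forall i x, cod i x -> (gram i x)^T = gram i x;
  gram_pos : forall i x (v : 'rV[R]_n), cod i x -> v != 0 ->
    0 < (v *m gram i x *m v^T) 0 0;
  gram_transition : forall i j p, dom i p -> dom j p ->
    let J := jacobian (phi j \o psi i) (phi i p) in
    gram i (phi i p) = J *m gram j (phi j p) *m J^T }.

Section riemannian.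
Context {R : realType} {n : nat}.

Definition closed_manifold (M : topologicalType) : Prop :=
  hausdorff_space M /\ compact [set: M].

(* The library builds generated sigma-algebras on pointed types only; for a
   manifold this just says that it is nonempty. *)
Definition borel (M : ptopologicalType) := g_sigma_algebraType (@open M).

Section operators.
Context {M : topologicalType} {A : smooth_atlas R n M}.
Variable g : riemannian_metric A.

Definition smooth (u : M -> R) : Prop :=
  forall i : chart A, smooth_on (cod i) (u \o psi i).

(* The density sqrt(det g) of the volume in the coordinates of chart i. *)
Definition sqrt_det (i : chart A) (x : 'rV[R]_n) : R :=
  Num.sqrt (\det (gram g i x)).

(* Components of grad u, resp. value of div X, in the coordinates of
   chart i. *)
Definition grad (i : chart A) (u : M -> R) (x : 'rV[R]_n) : 'rV[R]_n :=
  \row_k \sum_(l < n) invmx (gram g i x) k l * partial l (u \o psi i) x.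

Definition dvg (i : chart A) (X : 'rV[R]_n -> 'rV[R]_n) (x : 'rV[R]_n) : R :=
  (sqrt_det i x)^-1 *
    \sum_(k < n) partial k (fun y => sqrt_det i y * X y 0 k) x.

(* The functions Delta u and g(grad u, grad v) at p, computed in a chart i
   around p; for smooth u and v neither depends on i. *)
Definition laplace (i : chart A) (u : M -> R) (p : M) : R :=
  dvg i (grad i u) (phi i p).

Definition inner_grad (i : chart A) (u v : M -> R) (p : M) : R :=
  let x := phi i p in (grad i u x *m gram g i x *m (grad i v x)^T) 0 0.

Local Notation re f := (fun p => complex.Re (f p)).
Local Notation im f := (fun p => complex.Im (f p)).

Definition laplaceC (i : chart A) (f : M -> R[i]) (p : M) : R[i] :=
  (laplace i (re f) p +i* laplace i (im f) p)%C.

(* Complex-bilinear, not sesquilinear. *)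
Definition kappa (i : chart A) (f h : M -> R[i]) (p : M) : R[i] :=
  ((inner_grad i (re f) (re h) p - inner_grad i (im f) (im h) p) +i*
   (inner_grad i (re f) (im h) p + inner_grad i (im f) (re h) p))%C.

Definition eigenfunction (lambda mu : R[i]) (f : M -> R[i]) : Prop :=
  [/\ smooth (re f), smooth (im f) &
      forall i p, dom i p ->
        laplaceC i f p = lambda * f p /\ kappa i f f p = mu * f p ^+ 2].

End operators.

(* dV is the Riemannian volume measure dV_g: in each chart it has density
   sqrt(det g) with respect to Lebesgue measure. On a compact M this determines
   dV, since finitely many charts cover M. *)
Definition riemannian_volume (M : ptopologicalType) (A : smooth_atlas R n M)
    (g : riemannian_metric A) (dV : {measure set (borel M) -> \bar R}) : Prop :=
  forall (i : chart A) (B : set (borel M)), measurable B -> B `<=` dom i ->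
    dV B = lebesgue_nint
             (fun x => (sqrt_det g i x * \1_(phi i @` B) x)%:E).

End riemannian.

Definition locally_constant (M : topologicalType) (T : Type) (f : M -> T) :=
  forall p, \forall q \near p, f q = f p.

(* Main.v *)
(* Write w for the conjugate of f and Q = |grad f1|^2 + |grad f2|^2 = kappa(f, w).
   Testing Delta f = lambda f against f^j w^k in Green's identity gives
     (lambda + j mu) int f^(j+1) w^k = - k int f^j w^(k-1) Q,
   together with the complex conjugate relations. On the diagonal k = j + 1 all
   the integrals are real and, as f is not locally constant, nonzero; hence
   lambda and mu are real and lambda + j mu <> 0 for all j. Comparing the two
   families of relations then yields int f^j w^k = 0 for j <> k: the moments of
   (f1, f2) are those of a rotation invariant measure on the plane. Applying the
   rotation field x d/dy - y d/dx to x^a y^b, this says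
     b int f1^(a+1) f2^(b-1) = a int f1^(a-1) f2^(b+1),
   and both claims follow by induction.
   Green's identity is only needed for C^1 test functions; a partition of unity
   reduces it to the divergence theorem for compactly supported C^1 fields on
   R^n, that is, to Fubini and the fundamental theorem of calculus. *)

From HB Require Import structures.
Require Import Defs.
From mathcomp Require Import all_boot all_order all_algebra.
From mathcomp Require Import all_classical all_reals all_analysis.
From mathcomp Require Import perm measurable_realfun ring lra zify.
Set Implicit Arguments.
Unset Strict Implicit.
Unset Printing Implicit Defensive.
Import Order.TTheory GRing.Theory Num.Theory.
Import numFieldNormedType.Exports.
Local Open Scope classical_set_scope.
Local Open Scope ring_scope.

(** * C^1 functions on R^n *)

Section C1_calculus.
Context {R : realType}.

(** A nonzero constant is an eigenfunction with lambda = mu = 0 whose first moments do not both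
    vanish. This is why [f_nontriv] asks that f be zero, a case settled directly, or not locally
    constant. The diagonal moments serve to divide by. Cancelling int |f|^(2k+2) shows that lambda
    and mu are real, and int |f|^(2k) Q <> 0 excludes lambda + k mu = 0. All indices k matter:
    eliminating int f^j w^k Q from the two relations for the exponents j + 1 and k + 1 leaves the
    factor lambda + (j + k + 1) mu, whose index lies beyond those of the pair. Two obstacles shape
    the analysis. [lebesgue_nint] is only an iterated integral, without linearity or limit theorems,
    and has to be represented by a measure first. The maps [phi] and [psi] carry junk outside their
    domains, so regularity is always stated on an open set, and functions built in a chart are cut
    off or extended by zero explicitly. *)

Lemma is_derive_line n (f : 'rV[R]_n -> R) (y v : 'rV[R]_n) (t : R) :
  derivable f (y + t *: v) v ->
  is_derive t 1 (fun s : R => f (y + s *: v)) ('D_v f (y + t *: v)).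
Proof.
have E : (fun h : R => h^-1 *: (((fun s : R => f (y + s *: v)) \o shift t) (h *: 1)
            - f (y + t *: v))) =
    (fun h => h^-1 *: ((f \o shift (y + t *: v)) (h *: v) - f (y + t *: v))).
  apply/funext => h /=; congr (_ *: (f _ - _)).
  by rewrite [h *: 1]mulr1 scalerDl addrCA.
by move=> fd; split; rewrite /derivable /derive E.
Qed.

Lemma mean_value_line n (f : 'rV[R]_n -> R) (y v : 'rV[R]_n) :
  (forall t : R, 0 <= t <= 1 -> derivable f (y + t *: v) v) ->
  exists2 t : R, 0 <= t <= 1 & f (y + v) - f y = 'D_v f (y + t *: v).
Proof.
move=> fd; pose g s := f (y + s *: v).
have gd (s : R) : 0 <= s <= 1 -> is_derive s 1 g ('D_v f (y + s *: v)).
  by move=> s01; apply/is_derive_line/fd.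
have [|||t tI] := @MVT_segment R g (fun s => 'D_v f (y + s *: v)) 0 1.
- exact: ler01.
- by move=> s; rewrite in_itv/= => /andP[s0 s1]; apply: gd; rewrite !ltW.
- apply: derivable_within_continuous => s; rewrite in_itv/= => /gd[]//.
rewrite /g/= scale1r scale0r addr0 subr0 mulr1 => ->; exists t => //.
Qed.

Lemma near_eq_cvg_to (T U : topologicalType) (f g : T -> U) (x : T) (l : U) :
  (\forall y \near x, f y = g y) -> f @ x --> l -> g @ x --> l.
Proof. by move=> fg; apply: cvg_trans; exact: near_eq_cvg. Qed.

Lemma continuous_sumr (T : topologicalType) (I : Type) (r : seq I)
    (F : I -> T -> R) (x : T) :
  (forall i, {for x, continuous (F i)}) ->
  {for x, continuous (fun y => \sum_(i <- r) F i y)}.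
Proof.
move=> Fc; elim: r => [|i r IHr].
  rewrite (_ : (fun y => _) = cst 0); first exact: cvg_cst.
  by apply/funext => y; rewrite big_nil.
rewrite (_ : (fun y => _) = (fun y => F i y + \sum_(j <- r) F j y)).
  by apply: (@continuousD R); [exact: Fc|].
by apply/funext => y; rewrite big_cons.
Qed.

Lemma continuous_prodr (T : topologicalType) (I : Type) (r : seq I)
    (F : I -> T -> R) (x : T) :
  (forall i, {for x, continuous (F i)}) ->
  {for x, continuous (fun y => \prod_(i <- r) F i y)}.
Proof.
move=> Fc; elim: r => [|i r IHr].
  rewrite (_ : (fun y => _) = cst 1); first exact: cvg_cst.
  by apply/funext => y; rewrite big_nil.
rewrite (_ : (fun y => _) = (fun y => F i y * \prod_(j <- r) F j y)).
  by apply: (@continuousM R); [exact: Fc|].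
by apply/funext => y; rewrite big_cons.
Qed.

Lemma coord_le_norm n (v : 'rV[R]_n) (k : 'I_n) : `|v 0 k| <= `|v|.
Proof.
rewrite [leRHS]/Num.Def.normr/= mx_normrE.
exact: (le_bigmax _ (fun ij => `|v ij.1 ij.2|) (ord0, k)).
Qed.

Lemma norm_le_coord n (v : 'rV[R]_n) (r : R) :
  0 <= r -> (forall k, `|v 0 k| <= r) -> `|v| <= r.
Proof.
move=> r0 vr; rewrite [leLHS]/Num.Def.normr/= mx_normrE.
by apply: bigmax_le => // -[i k] _ /=; rewrite ord1.
Qed.

(** [smooth_on] speaks of partial derivatives only, whereas the chain rule needs total
    differentiability. Walking from x to x + v one coordinate at a time, the mean value theorem
    turns each leg into a partial derivative at a nearby point, which continuity compares with the
    one at x. *)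
Lemma continuous_partial_differentiable n (f : 'rV[R]_n -> R) (x : 'rV[R]_n) :
  (\forall y \near x, forall k, derivable f y (delta_mx 0 k)) ->
  (forall k, {for x, continuous (partial k f)}) ->
  differentiable f x.
Proof.
move=> fd fc.
pose df (v : 'rV[R]_n) : R := \sum_k v 0 k * partial k f x.
have dflin : linear df.
  move=> a u v; rewrite /df scaler_sumr -big_split; apply: eq_bigr => k _.
  by rewrite !mxE mulrDl [_ *: _]mulrA.
pose dfM := GRing.isLinear.Build _ _ _ _ _ dflin.
pose dfL : {linear 'rV[R]_n -> R} := HB.pack df dfM.
have dfc : continuous dfL.
  move=> v; apply: continuous_sumr => k.
  by apply: (@continuousM R _ (fun v : 'rV[R]_n => v 0 k) (cst (partial k f x)));
    [exact: coord_continuous|exact: cst_continuous].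
suff E : f \o shift x = (cst (f x) + dfL : 'rV[R]_n -> R^o) +o_ (0 : 'rV[R]_n) id.
  have dE := @diff_unique R _ R f dfL x dfc E.
  by apply/diff_locallyP; rewrite dE; split.
apply/eqaddoP => _/posnumP[e].
(* The error is shared among n legs; dividing by n + 1 rather than n keeps the quotient meaningful
   for n = 0. *)
have e0 : 0 < e%:num / n.+1%:R by rewrite divr_gt0.
have : \forall y \near x, forall k,
    derivable f y (delta_mx 0 k) /\
    `|partial k f y - partial k f x| <= e%:num / n.+1%:R.
  near=> y => k; split; first by move: k; near: y.
  rewrite distrC; move: k; near: y; apply: filter_forall => k.
  by have := fc k; rewrite /prop_for /continuous_at => /cvgrPdist_le/(_ _ e0).
move=> /nbhs_ballP[d /= d0 dP].
near=> v.
have vd : `|v| < d.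
  near: v; apply/nbhs_ballP; exists d => // v.
  by rewrite -ball_normE/= sub0r normrN.
(* The first j coordinates of v: the corner reached after j legs. *)
pose w j : 'rV[R]_n := \row_k (if (k < j)%N then v 0 k else 0).
have wle j : (forall k, `|w j 0 k| <= `|v|).
  by move=> k; rewrite mxE; case: ifP => _; rewrite ?normr0 ?coord_le_norm.
have step (j : 'I_n) : `|f (x + w j.+1) - f (x + w j) - v 0 j * partial j f x|
    <= e%:num / n.+1%:R * `|v|.
  pose g s := f (x + w j + s *: delta_mx 0 j).
  have inb (s : R) : `|s| <= `|v 0 j| -> ball x d (x + w j + s *: delta_mx 0 j).
    move=> sv; rewrite -ball_normE/= opprD opprD addrA addrA subrr sub0r -opprD
      normrN.
    apply: le_lt_trans vd; apply: norm_le_coord => // k; rewrite !mxE eqxx/=.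
    have [->|kj] := eqVneq k j.
      by rewrite ltnn add0r mulr1 (le_trans sv) ?coord_le_norm.
    by rewrite mulr0 addr0; have := wle j k; rewrite mxE.
  have gd (s : R) : `|s| <= `|v 0 j| -> is_derive s 1 g
    (partial j f (x + w j + s *: delta_mx 0 j)).
    by move=> sv; apply: is_derive_line; have [] := dP _ (inb _ sv) j.
  have wS : x + w j.+1 = x + w j + v 0 j *: delta_mx 0 j.
    rewrite -addrA; congr (_ + _); apply/rowP => k; rewrite !mxE eqxx/=
      ltnS leq_eqVlt.
    have [->|kj] := eqVneq k j; first by rewrite eqxx/= ltnn add0r mulr1.
    by rewrite (negbTE (kj : (k : nat) != j)) mulr0 addr0.
  have w0 : x + w j = x + w j + (0 : R) *: delta_mx 0 j by rewrite scale0r addr0.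
  suff [s sv ->] : exists2 s, `|s| <= `|v 0 j| & f (x + w j.+1) - f (x + w j) =
       partial j f (x + w j + s *: delta_mx 0 j) * v 0 j.
    rewrite (mulrC (v 0 j)) -mulrBl normrM ler_pM//; last exact: coord_le_norm.
    by have [_] := dP _ (inb _ sv) j.
  rewrite wS [in X in _ - X]w0 -!/(g _).
  (* [MVT_segment] takes ordered endpoints, hence one case for each sign of the increment. *)
  have [v0|v0] := leP 0 (v 0 j).
    have sI (s : R) : s \in `[0, v 0 j] -> `|s| <= `|v 0 j|.
      by rewrite in_itv/= => /andP[s0 sv]; rewrite !ger0_norm.
    have [|||s sv] := @MVT_segment R g (fun s =>
      partial j f (x + w j + s *: delta_mx 0 j)) 0 (v 0 j).
    - by [].
    - by move=> s sv; apply/gd/sI/subset_itv_oo_cc.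
    - by apply: derivable_within_continuous => s /sI/gd[]//.
    by rewrite subr0 => ->; exists s => //; exact: sI.
  have sI (s : R) : s \in `[v 0 j, 0] -> `|s| <= `|v 0 j|.
    by rewrite in_itv/= => /andP[s0 sv]; rewrite !ler0_norm ?lerN2// ltW.
  have [|||s sv] := @MVT_segment R g (fun s =>
    partial j f (x + w j + s *: delta_mx 0 j)) (v 0 j) 0.
  - exact: ltW.
  - by move=> s sv; apply/gd/sI/subset_itv_oo_cc.
  - by apply: derivable_within_continuous => s /sI/gd[]//.
  rewrite sub0r => /(congr1 -%R); rewrite opprB mulrN opprK => ->.
  by exists s => //; exact: sI.
have tele : f (x + v) - f x = \sum_(j < n) (f (x + w j.+1) - f (x + w j)).
  have wn : w n = v by apply/rowP => k; rewrite mxE ltn_ord.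
  have w0 : w 0%N = 0 by apply/rowP => k; rewrite !mxE.
  by rewrite -(big_mkord xpredT (fun j => f (x + w j.+1) - f (x + w j)))
     telescope_sumr// wn w0 addr0.
rewrite /= !fctE /= opprD addrA [v + x]addrC tele /df -sumrB.
apply: le_trans (ler_norm_sum _ _ _) _.
apply: le_trans (ler_sum _ (fun j _ => step j)) _.
rewrite sumr_const card_ord -[X in X <= _]mulr_natl mulrA ler_wpM2r//.
rewrite mulrCA ler_piMr// ler_pdivrMr// mul1r ler_nat//.
Unshelve. all: by end_near. Qed.


(* Meant for open U: the values of h outside U are then irrelevant. *)
Definition C1on n (U : set 'rV[R]_n) (h : 'rV[R]_n -> R) :=
  forall x, U x -> differentiable h x /\ forall k, {for x, continuous (partial k h)}.

Section closure.
Variables (n : nat) (U : set 'rV[R]_n).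
Implicit Types f g : 'rV[R]_n -> R.

Lemma near_eq_partial f g x (k : 'I_n) :
  {near x, f =1 g} -> partial k f x = partial k g x.
Proof. exact: near_eq_derive. Qed.

Lemma near_eq_differentiable f g x :
  {near x, f =1 g} -> differentiable f x -> differentiable g x.
Proof.
move=> fg fd.
suff E : g \o shift x = (cst (g x) + 'd f x : 'rV[R]_n -> R^o) +o_ (0 : 'rV[R]_n) id.
  have dE := @diff_unique R _ R g ('d f x) x (diff_continuous fd) E.
  by apply/diff_locallyP; rewrite dE; split => //; exact: diff_continuous.
have /diff_locally/eqaddoP fo := fd.
apply/eqaddoP => e e0; have := fo e e0; apply: filter_app.
have -> : g x = f x by rewrite (nbhs_singleton fg).
move: fg; rewrite (near_shift 0 x) subr0; apply: filterS => y /=.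
by rewrite !fctE /= => ->.
Qed.

Lemma C1on_continuous f x : C1on U f -> U x -> {for x, continuous f}.
Proof. by move=> fC /fC[/differentiable_continuous]. Qed.

Lemma C1on_near f g x : open U -> U x -> C1on U f ->
  (forall y, U y -> f y = g y) -> differentiable g x /\
  forall k, {for x, continuous (partial k g)}.
Proof.
move=> oU Ux fC fg.
have Un y : U y -> \forall z \near y, f z = g z.
  by move=> Uy; apply: filterS (open_nbhs_nbhs (conj oU Uy)) => z /fg.
have [fd fc] := fC x Ux; split; first exact: near_eq_differentiable (Un _ Ux) fd.
move=> k; rewrite /prop_for /continuous_at -(near_eq_partial k (Un _ Ux)).
apply: near_eq_cvg_to (fc k).
by apply: filterS (open_nbhs_nbhs (conj oU Ux)) => y /Un/near_eq_partial.
Qed.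

Lemma eq_C1on f g : open U -> (forall y, U y -> f y = g y) ->
  C1on U f -> C1on U g.
Proof. by move=> oU fg fC x Ux; exact: C1on_near Ux fC fg. Qed.

Lemma C1onP f (D : 'I_n -> 'rV[R]_n -> R) : open U ->
  (forall x, U x -> differentiable f x) ->
  (forall x k, U x -> partial k f x = D k x) ->
  (forall x k, U x -> {for x, continuous (D k)}) -> C1on U f.
Proof.
move=> oU fd fD Dc x Ux; split=> [|k]; first exact: fd.
rewrite /prop_for /continuous_at fD//; apply: near_eq_cvg_to (Dc x k Ux).
by apply: filterS (open_nbhs_nbhs (conj oU Ux)) => y /(fD _ k).
Qed.

Lemma smooth_C1on f : open U -> smooth_on U f -> C1on U f.
Proof.
move=> oU fs x Ux; split=> [|k]; last by have [+ _] := fs [:: k]; apply; rewrite inE.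
apply: continuous_partial_differentiable => [|k].
  apply: filterS (open_nbhs_nbhs (conj oU Ux)) => y Uy k.
  by have [_] := fs [::]; exact.
by have [+ _] := fs [:: k]; apply; rewrite inE.
Qed.

Lemma smooth_partial f k : smooth_on U f -> smooth_on U (partial k f).
Proof. by move=> fs s; have := fs (rcons s k); rewrite /partials foldr_rcons. Qed.

Lemma partial_cst (c : R) (k : 'I_n) x : partial k (fun=> c) x = 0 :> R.
Proof. exact: (@derive_cst R 'rV[R]_n R). Qed.

Lemma partialD f g x k : differentiable f x -> differentiable g x ->
  partial k (fun y => f y + g y) x = partial k f x + partial k g x.
Proof.
move=> fd gd.
by rewrite /partial -[RHS](@deriveD R 'rV[R]_n R)//; exact: diff_derivable.
Qed.

Lemma partialM f g x k : differentiable f x -> differentiable g x ->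
  partial k (fun y => f y * g y) x = f x * partial k g x + g x * partial k f x.
Proof.
move=> fd gd.
by rewrite /partial -[RHS](@deriveM R 'rV[R]_n)//; exact: diff_derivable.
Qed.

Lemma partialV f x k : differentiable f x -> f x != 0 ->
  partial k (fun y => (f y)^-1) x = - (f x)^-2 * partial k f x.
Proof.
by move=> fd f0; rewrite /partial (@deriveV R 'rV[R]_n)//; exact: diff_derivable.
Qed.

Lemma partialN f x k : differentiable f x ->
  partial k (fun y => - f y) x = - partial k f x.
Proof.
by move=> fd; rewrite /partial -[RHS](@deriveN R 'rV[R]_n R)//; exact: diff_derivable.
Qed.

Lemma C1on_cst (c : R) : C1on U (fun=> c).
Proof.
move=> x Ux; split; first exact: differentiable_cst.
move=> k; rewrite (_ : partial k _ = cst 0); first exact: cst_continuous.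
by apply/funext => y; rewrite partial_cst.
Qed.

Lemma C1onD f g : open U -> C1on U f -> C1on U g -> C1on U (fun x => f x + g x).
Proof.
move=> oU fC gC.
apply: (@C1onP _ (fun k y => partial k f y + partial k g y)) => //.
- by move=> x Ux; apply: (@differentiableD R 'rV[R]_n R);
  [case: (fC x Ux)|case: (gC x Ux)].
- by move=> x k Ux; rewrite partialD//; [case: (fC x Ux)|case: (gC x Ux)].
- move=> x k Ux; have [_ fc] := fC x Ux; have [_ gc] := gC x Ux.
  exact: (@continuousD R).
Qed.

Lemma C1onN f : open U -> C1on U f -> C1on U (fun x => - f x).
Proof.
move=> oU fC.
apply: (@C1onP _ (fun k y => - partial k f y)) => //.
- by move=> x Ux; apply: (@differentiableN R 'rV[R]_n R); case: (fC x Ux).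
- by move=> x k Ux; rewrite partialN//; case: (fC x Ux).
- by move=> x k Ux; have [_ fc] := fC x Ux; exact: (@continuousN R).
Qed.

Lemma C1onM f g : open U -> C1on U f -> C1on U g -> C1on U (fun x => f x * g x).
Proof.
move=> oU fC gC.
apply: (@C1onP _ (fun k y => f y * partial k g y + g y * partial k f y)) => //.
- by move=> x Ux; apply: (@differentiableM R 'rV[R]_n);
  [case: (fC x Ux)|case: (gC x Ux)].
- by move=> x k Ux; rewrite partialM//; [case: (fC x Ux)|case: (gC x Ux)].
- move=> x k Ux; have [_ fc] := fC x Ux; have [_ gc] := gC x Ux.
  have fk := C1on_continuous fC Ux; have gk := C1on_continuous gC Ux.
  by apply: (@continuousD R); apply: (@continuousM R).
Qed.

Lemma C1onV f : open U -> C1on U f -> (forall x, U x -> f x != 0) ->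
  C1on U (fun x => (f x)^-1).
Proof.
move=> oU fC f0.
apply: (@C1onP _ (fun k y => - (f y * f y)^-1 * partial k f y)) => //.
- by move=> x Ux; apply: (@differentiableV R 'rV[R]_n) (f0 x Ux); case: (fC x Ux).
- by move=> x k Ux; rewrite partialV//; [case: (fC x Ux)|exact: f0].
- move=> x k Ux; have [_ fc] := fC x Ux; have fk := C1on_continuous fC Ux.
  apply: (@continuousM R) => //; apply: (@continuousN R).
  apply: (@continuousV R); first by rewrite mulf_neq0// f0.
  exact: (@continuousM R).
Qed.

Lemma C1on_comp1 f (phi dphi : R -> R) : open U -> C1on U f ->
  (forall x, U x -> is_derive (f x) 1 phi (dphi (f x))) ->
  (forall x, U x -> {for f x, continuous dphi}) ->
  C1on U (fun x => phi (f x)).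
Proof.
move=> oU fC sd sc.
have df x : U x -> differentiable phi (f x) by move=> /sd[/derivable1_diffP].
apply: (@C1onP _ (fun k y => dphi (f y) * partial k f y)) => //.
- move=> x Ux; apply: (@differentiable_comp R 'rV[R]_n R R f phi);
  first by case: (fC x Ux).
  exact: df.
- move=> x k Ux; have [fd _] := fC x Ux.
  rewrite /partial deriveE; last exact: (@differentiable_comp R 'rV[R]_n R R f phi _
    fd (df _ Ux)).
  rewrite (@diff_comp R 'rV[R]_n R R f phi _ fd (df _ Ux))/=.
  have lin (L : {linear R -> R}) r : L r = L 1 * r.
    by have := linearZ_LR L r (1 : R); rewrite [r *: 1]mulr1 => ->; rewrite mulrC.
  rewrite lin -(deriveE (delta_mx 0 k) fd) -(deriveE (1 : R) (df _ Ux)).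
  by have [_ ->] := sd _ Ux.
- move=> x k Ux; have [_ fc] := fC x Ux; have fk := C1on_continuous fC Ux.
  by apply: (@continuousM R) => //; apply: continuous_comp => //; exact: sc.
Qed.

Lemma C1on_sqrt f : open U -> C1on U f -> (forall x, U x -> 0 < f x) ->
  C1on U (fun x => Num.sqrt (f x)).
Proof.
move=> oU fC f0; apply: (@C1on_comp1 f Num.sqrt (fun s => (2 * Num.sqrt s)^-1)) => //.
  by move=> x /f0; exact: is_derive1_sqrt.
move=> x Ux; apply: (@continuousV R); first by rewrite mulf_neq0// gt_eqF//
  sqrtr_gt0 f0.
by apply: (@continuousM R); [exact: cst_continuous|exact: sqrt_continuous].
Qed.

Lemma C1on_sum (I : Type) (r : seq I) (F : I -> 'rV[R]_n -> R) : open U ->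
  (forall i, C1on U (F i)) -> C1on U (fun x => \sum_(i <- r) F i x).
Proof.
move=> oU FC; elim: r => [|i r IHr].
  by apply: (eq_C1on oU _ (C1on_cst 0)) => y _; rewrite big_nil.
by apply: (eq_C1on oU _ (C1onD oU (FC i) IHr)) => y _; rewrite big_cons.
Qed.

Lemma C1on_prod (I : Type) (r : seq I) (F : I -> 'rV[R]_n -> R) : open U ->
  (forall i, C1on U (F i)) -> C1on U (fun x => \prod_(i <- r) F i x).
Proof.
move=> oU FC; elim: r => [|i r IHr].
  by apply: (eq_C1on oU _ (C1on_cst 1)) => y _; rewrite big_nil.
by apply: (eq_C1on oU _ (C1onM oU (FC i) IHr)) => y _; rewrite big_cons.
Qed.

Lemma C1onX f m : open U -> C1on U f -> C1on U (fun x => f x ^+ m).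
Proof.
move=> oU fC; elim: m => [|m IHm].
  by apply: (eq_C1on oU _ (C1on_cst 1)) => y _; rewrite expr0.
by apply: (eq_C1on oU _ (C1onM oU fC IHm)) => y _; rewrite exprS.
Qed.

Lemma C1on_det m (F : 'rV[R]_n -> 'M[R]_m) : open U ->
  (forall i j, C1on U (fun x => F x i j)) -> C1on U (fun x => \det (F x)).
Proof.
move=> oU FC; apply: C1on_sum => // s; apply: C1onM => //; first exact: C1on_cst.
by apply: C1on_prod.
Qed.

(** By Cramer's rule an entry of the inverse is a cofactor over the determinant, and both are
    polynomial in the entries. *)
Lemma C1on_invmx m (F : 'rV[R]_n -> 'M[R]_m) i j : open U ->
  (forall i j, C1on U (fun x => F x i j)) -> (forall x, U x -> F x \in unitmx) ->
  C1on U (fun x => invmx (F x) i j).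
Proof.
move=> oU FC Fu.
have : C1on U (fun x => (\det (F x))^-1 * ((-1) ^+
  (j + i) * \det (row' j (col' i (F x))))).
  apply: C1onM => //.
    apply: C1onV => //; first exact: C1on_det.
    by move=> x /Fu; rewrite unitmxE unitfE.
  apply: C1onM => //; first exact: C1on_cst.
  apply: C1on_det => // k l; apply: eq_C1on (FC (lift j k) (lift i l)) => // y _.
  by rewrite !mxE.
by apply: eq_C1on => // y Uy; rewrite /invmx Fu// !mxE.
Qed.

End closure.


Section composition.
Variables (m n : nat) (T : 'rV[R]_m -> 'rV[R]_n).

Lemma differentiable_coords x :
  (forall l, differentiable (fun y => T y 0 l) x) -> differentiable T x.
Proof.
move=> Td.
have -> : T = \sum_(l < n) (fun y => T y 0 l *: (delta_mx 0 l : 'rV[R]_n)).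
  apply/funext => y; rewrite fct_sumE; apply/rowP => j.
  rewrite summxE (bigD1 j)//= !mxE !eqxx mulr1 big1 ?addr0// => i ij.
  by rewrite !mxE [j == i]eq_sym (negbTE ij) mulr0.
by apply: differentiable_sum => l; exact: differentiableZl.
Qed.

Lemma jacobianE x k l : differentiable T x ->
  jacobian T x k l = partial k (fun y => T y 0 l) x.
Proof.
move=> Td.
have Tk : derivable T x (delta_mx 0 k) by exact: diff_derivable.
rewrite /partial -[RHS](_ : 'D_(delta_mx 0 k) T x 0 l = _); last first.
  by rewrite derive_mx// mxE.
by rewrite deriveEjacobian// -rowE [RHS]mxE.
Qed.

Lemma partial_comp (h : 'rV[R]_n -> R) x (k : 'I_m) :
  (forall l, differentiable (fun y => T y 0 l) x) -> differentiable h (T x) ->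
  partial k (h \o T) x =
  \sum_l partial k (fun y => T y 0 l) x * partial l h (T x).
Proof.
move=> /differentiable_coords Td hd.
rewrite {1}/partial deriveE; last exact: differentiable_comp.
rewrite diff_comp//= -(deriveE (delta_mx 0 k : 'rV[R]_m) Td) deriveEjacobian// -rowE.
rewrite [X in 'd h _ X]row_sum_delta linear_sum/=; apply: eq_bigr => l _.
by rewrite linearZ_LR/= -deriveE// [row k _ 0 l]mxE jacobianE.
Qed.

Lemma C1on_comp (U : set 'rV[R]_m) (V : set 'rV[R]_n) (h : 'rV[R]_n -> R) :
  open U -> (forall x, U x -> V (T x)) ->
  (forall l, C1on U (fun y => T y 0 l)) -> C1on V h -> C1on U (h \o T).
Proof.
move=> oU UV TC hC.
have Tld x l : U x -> differentiable (fun y => T y 0 l) x by move=> /(TC l)[].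
have hd x : U x -> differentiable h (T x) by move=> /UV/hC[].
have Td x : U x -> differentiable T x.
  by move=> Ux; apply: differentiable_coords => l; exact: Tld.
apply: (@C1onP _ _ _ (fun k x =>
  \sum_l partial k (fun y => T y 0 l) x * partial l h (T x))) => //.
- by move=> x Ux; apply: differentiable_comp; [exact: Td|exact: hd].
- by move=> x k Ux; rewrite partial_comp => // [l|]; [exact: Tld|exact: hd].
- move=> x k Ux; apply: continuous_sumr => l; apply: (@continuousM R).
    by have [_] := TC l x Ux.
  apply: continuous_comp; first exact: differentiable_continuous (Td _ Ux).
  by have [_] := hC _ (UV _ Ux).
Qed.

End composition.
End C1_calculus.

(** * Lebesgue measure on R^n *)

Section borel.

Lemma measurable_open (T : ptopologicalType) (U : set T) :
  open U -> measurable (U : set (borel T)).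
Proof. exact: sub_sigma_algebra. Qed.

Lemma measurable_closed (T : ptopologicalType) (U : set T) :
  closed U -> measurable (U : set (borel T)).
Proof.
move=> Uc; rewrite -[U]setCK; apply: (@measurableC _ (borel T)).
by apply: measurable_open; exact: closed_openC.
Qed.

Lemma continuous_borel_measurable (R : realType) (T : ptopologicalType)
    (D : set T) (f : T -> R) : open D ->
  (forall x, D x -> {for x, continuous f}) ->
  measurable_fun (D : set (borel T)) (f : borel T -> R).
Proof.
move=> oD fc; apply: (measurability _ (RGenOInfty.measurableE R)).
move=> _ [_ [a ->] <-]; apply: measurable_open.
rewrite openE => x [Dx fx]; apply: filterI; first exact: open_nbhs_nbhs.
by apply: (fc x Dx); apply: open_nbhs_nbhs; split => //; exact: interval_open.
Qed.

Lemma continuous_borel_fun (T U : ptopologicalType) (f : T -> U) :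
  continuous f -> measurable_fun setT (f : borel T -> borel U).
Proof.
move=> fc; apply: (@measurability _ _ (borel T) (borel U) setT f (@open U) erefl).
move=> _ [V oV <-].
by rewrite setTI; apply: measurable_open; apply: open_comp => // x _; exact: fc.
Qed.

End borel.

Section rational_balls.
Context {R : realType} (n : nat).

(** A countable base of R^n. It links the product sigma-algebra, generated by measurable rectangles,
    with [borel], generated by arbitrary open sets. *)
Definition rational_ball (i : 'rV[rat]_n * nat) : set 'rV[R]_n :=
  ball (map_mx ratr i.1 : 'rV[R]_n) i.2.+1%:R^-1.

Lemma open_rational_balls (O : set 'rV[R]_n) : open O ->
  O = \bigcup_(i in [set i | rational_ball i `<=` O]) rational_ball i.
Proof.
move=> oO; apply/seteqP; split=> [x Ox|x [i /= iO]]; last exact: iO.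
have /nbhs_ballP[e /= e0 xeO] := open_nbhs_nbhs (conj oO Ox).
(* Since k + 1 > 2 / e, two steps of length r, from x to the rational center and on to y, stay
   within e. *)
pose k := Num.truncn (2 / e); pose r : R := k.+1%:R^-1.
have r0 : 0 < r by rewrite invr_gt0.
have re : r + r <= e.
  rewrite -mulr2n -mulr_natl /r ler_pdivrMr// mulrC -ler_pdivrMr// ltW//.
  by rewrite truncnS_gt.
have /choice[q qx] (j : 'I_n) : exists q : rat, ratr q \in `]x 0 j - r, x 0 j + r[.
  by apply: rat_in_itvoo; rewrite ltrD2l gtrN.
have xq : ball (map_mx ratr (\row_j q j) : 'rV[R]_n) r x.
  split=> // i j; rewrite ord1 !mxE /ball/= -[_ - _]opprB normrN ltr_distl.
  by have := qx j; rewrite in_itv/= => /andP[+ +]; rewrite ltrBlDr ltrBlDr => -> ->.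
exists (\row_j q j, k) => //= y yq; apply: xeO.
by apply: (le_ball re); exact: ball_triangle (ball_sym xq) yq.
Qed.

End rational_balls.

Section nint_measure.
Context {R : realType}.

Lemma ex_sigma_finite_measure d (T : measurableType d)
    (m : {measure set T -> \bar R}) : sigma_finite setT m ->
  exists nu : {sigma_finite_measure set T -> \bar R}, (nu : set T -> \bar R) = m.
Proof.
case: m => f c /= sf.
pose m : {measure set T -> \bar R} := Measure.Pack c.
pose S := Measure_isSigmaFinite.Build _ _ _ m sf.
pose nu : {sigma_finite_measure set T -> \bar R} := HB.pack f c S.
by exists nu.
Qed.

Lemma sigma_finite_product_measure d1 d2 (T1 : measurableType d1)
    (T2 : measurableType d2) (m1 : {sigma_finite_measure set T1 -> \bar R})
    (m2 : {sigma_finite_measure set T2 -> \bar R}) :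
  sigma_finite setT (m1 \x m2)%E.
Proof.
have /sigma_finiteP[F [TF ndF Foo]] := sigma_finiteT m1.
have /sigma_finiteP[G [TG ndG Goo]] := sigma_finiteT m2.
exists (fun k => F k `*` G k).
  apply/seteqP; split=> // -[x y] _.
  have [i _ Fx] : (\bigcup_i F i) x by rewrite -TF.
  have [j _ Gy] : (\bigcup_i G i) y by rewrite -TG.
  exists (maxn i j) => //; split.
    exact: (subsetPset _ _ (ndF _ _ (leq_maxl i j))).
  exact: (subsetPset _ _ (ndG _ _ (leq_maxr i j))).
move=> k; have [mF Fk] := Foo k; have [mG Gk] := Goo k; split.
  exact: measurableX.
by rewrite product_measure1E// lte_mul_pinfty// ge0_fin_numE.
Qed.

(** The measurable inverse g carries an exhaustion by sets of finite measure over to T2; without it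
    a pushforward may fail to be sigma-finite. *)
Lemma ex_pushforward d1 d2 (T1 : measurableType d1) (T2 : measurableType d2)
    (mu : {measure set T1 -> \bar R}) (f : T1 -> T2) (g : T2 -> T1) :
  sigma_finite setT mu -> measurable_fun setT f -> measurable_fun setT g ->
    cancel f g -> cancel g f ->
  exists nu : {sigma_finite_measure set T2 -> \bar R},
    forall h : T2 -> \bar R, measurable_fun setT h -> (forall x, 0 <= h x)%E ->
    (\int[nu]_y h y = \int[mu]_x h (f x))%E.
Proof.
move=> [F FT mF] mf mg fK gK.
pose m : {measure set T2 -> \bar R} :=
  measure_function_pushforward__canonical__measure_function_Measure mu mf.
have sf : sigma_finite setT m.
  exists (fun i => g @^-1` F i).
    by rewrite -preimage_bigcup -FT.
  move=> i; split; first by rewrite -[X in measurable X]setTI; apply: mg => //;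
    case: (mF i).
  rewrite /m/= /pushforward (_ : f @^-1` _ = F i); first by case: (mF i).
  by apply/seteqP; split => x /=; rewrite fK.
have [nu nuE] := ex_sigma_finite_measure sf.
exists nu => h mh h0.
by rewrite nuE ge0_integral_pushforward.
Qed.

Definition scons m (p : measurableTypeR R * borel 'rV[R]_m) : borel 'rV[R]_m.+1 :=
  row_mx (p.1%:M : 'rV_1) p.2.
Definition suncons m (x : borel 'rV[R]_m.+1) : measurableTypeR R * borel 'rV[R]_m :=
  (x 0 0, rsubmx (x : 'rV[R]_(1 + m))).

Lemma sconsK m : cancel (@scons m) (@suncons m).
Proof.
move=> [t y]; rewrite /suncons /scons /= row_mxKr; congr pair.
transitivity ((t%:M : 'rV[R]_1) 0 0); last by rewrite mxE.
by rewrite -(row_mxEl (t%:M : 'rV[R]_1) y); congr (fun_of_matrix _ _ _);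
  exact: val_inj.
Qed.

Lemma sunconsK m : cancel (@suncons m) (@scons m).
Proof.
move=> x; rewrite /suncons /scons /=.
suff -> : (x 0 0)%:M = lsubmx (x : 'rV[R]_(1 + m)) by exact: (@hsubmxK R 1 1 m x).
by apply/rowP => i; rewrite !mxE !ord1 mulr1n; congr (x _ _); exact: val_inj.
Qed.


Lemma scons_cont m (t : R) (y : 'rV[R]_m) (k : 'I_m) :
  scons (t, y) 0 (lift 0 k) = y 0 k.
Proof.
rewrite -(row_mxEr (t%:M : 'rV[R]_1) y); congr (fun_of_matrix _ _ _); exact: val_inj.
Qed.

Lemma scons0 m (t : R) (y : 'rV[R]_m) : scons (t, y) 0 0 = t.
Proof. by have := sconsK (t, y) => -[]. Qed.

Lemma measurable_scons m : measurable_fun setT (@scons m).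
Proof.
apply: (@measurability _ _ _ (borel 'rV[R]_m.+1) setT (@scons m) (@open _) erefl).
move=> _ [V oV <-]; rewrite setTI (open_rational_balls oV) preimage_bigcup.
rewrite bigcup_mkcond; apply: countable_bigcupT_measurable => [|[q k]];
  first exact: countableP.
case: ifPn => _ //.
pose r : R := k.+1%:R^-1.
(* Balls of the sup norm are boxes, so the preimage of one is the product of a ball of R and a ball
   of R^m. *)
rewrite [X in measurable X](_ : _ = ball (ratr (q 0 0) : R) r `*` ball
  (map_mx ratr (\row_j q 0 (lift 0 j)) : 'rV[R]_m) r).
  apply: measurableX; last by apply: measurable_open; exact: ball_open.
  exact: measurable_ball.
apply/seteqP; split => [[t y]/=|[t y]/= [t1 [_ y1]]].
  move=> [r0 B]; split; first by have := B 0 0; rewrite scons0 mxE.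
  by split=> // i j; rewrite ord1; have := B 0 (lift 0 j); rewrite scons_cont !mxE.
split=> [|i j]; first by rewrite invr_gt0.
rewrite ord1; have [j0 ->|->] := unliftP 0 j.
  by rewrite scons_cont; have := y1 0 j0; rewrite !mxE.
by rewrite scons0 mxE.
Qed.

Lemma continuous_rsubmx m : continuous (fun x : 'rV[R]_(1 + m) => rsubmx x).
Proof. by move=> x; apply: differentiable_continuous; exact: differentiable_rsubmx.
  Qed.

Lemma measurable_suncons m : measurable_fun setT (@suncons m).
Proof.
apply/measurable_fun_pairP; split.
  by apply: continuous_borel_measurable; [exact: openT|move=> x _;
    exact: coord_continuous].
by apply: (@continuous_borel_fun 'rV[R]_(1 + m) 'rV[R]_m); exact: continuous_rsubmx.
Qed.

(* Iterated integration is turned into integration against a measure, so that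
   linearity, Fubini and convergence theorems become available. *)
Lemma ex_nint_measure n : exists nu : {sigma_finite_measure set (borel 'rV[R]_n) ->
  \bar R},
  forall h : borel 'rV[R]_n -> \bar R, measurable_fun setT h ->
    (forall x, 0 <= h x)%E ->
  lebesgue_nint h = (\int[nu]_x h x)%E.
Proof.
elim: n => [|m [nu IH]].
  exists (\d_ (0 : borel 'rV[R]_0)) => h mh h0.
  by rewrite integral_dirac// diracT mul1e.
pose P : {measure set (measurableTypeR R * borel 'rV[R]_m)%type -> \bar R} :=
  (@lebesgue_measure R \x nu)%E.
have [nu' nuE] := ex_pushforward (sigma_finite_product_measure (@lebesgue_measure R)
  nu) (@measurable_scons m)
  (@measurable_suncons m) (@sconsK m) (@sunconsK m).
exists nu' => h mh h0.
rewrite nuE// fubini_tonelli1//; last first.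
  by apply: measurableT_comp => //; exact: measurable_scons.
apply: eq_integral => t _; apply: (IH (fun y => h (scons (t, y)))) => //.
apply: measurableT_comp => //.
by apply: (measurableT_comp (measurable_scons (m := m))); exact: pair1_measurable.
Qed.

End nint_measure.

(** * Cubes and integrals of compactly supported functions *)

Section nint_theory.
Context {R : realType}.

Definition nint_measure n : {sigma_finite_measure set (borel 'rV[R]_n) -> \bar R} :=
  sval (cid (@ex_nint_measure R n)).

Lemma nint_measureE n (h : borel 'rV[R]_n -> \bar R) :
  measurable_fun setT h -> (forall x, 0 <= h x)%E ->
  lebesgue_nint h = (\int[nint_measure n]_x h x)%E.
Proof. exact: (svalP (cid (@ex_nint_measure R n))). Qed.

Lemma integral_nint0 (h : borel 'rV[R]_0 -> \bar R) :
  measurable_fun setT h -> (forall x, 0 <= h x)%E ->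
  (\int[nint_measure 0]_x h x)%E = h 0.
Proof. by move=> mh h0; rewrite -nint_measureE. Qed.

Lemma measurable_slice m (h : borel 'rV[R]_m.+1 -> \bar R) :
  measurable_fun setT h -> measurable_fun setT (fun p => h (scons p)).
Proof. by move=> mh; apply: measurableT_comp => //; exact: measurable_scons. Qed.

Lemma ge0_integral_nintS m (h : borel 'rV[R]_m.+1 -> \bar R) :
  measurable_fun setT h -> (forall x, 0 <= h x)%E ->
  (\int[nint_measure m.+1]_x h x =
   \int[@lebesgue_measure R \x nint_measure m]_p h (scons p))%E.
Proof.
move=> mh h0; rewrite -nint_measureE// fubini_tonelli1//;
  last exact: measurable_slice.
apply: eq_integral => t _;
  apply: (@nint_measureE m (fun y => h (scons (t, y)))) => //.
apply: measurableT_comp => //.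
by apply: (measurableT_comp (measurable_scons (m := m))); exact: pair1_measurable.
Qed.

Lemma integral_nintS m (h : borel 'rV[R]_m.+1 -> \bar R) :
  measurable_fun setT h ->
  (\int[nint_measure m.+1]_x h x =
   \int[@lebesgue_measure R \x nint_measure m]_p h (scons p))%E.
Proof.
move=> mh; rewrite integralE [RHS]integralE.
have mp : measurable_fun setT (h^\+)%E by exact: measurable_funepos.
have mn : measurable_fun setT (h^\-)%E by exact: measurable_funeneg.
rewrite (ge0_integral_nintS mp)// (ge0_integral_nintS mn)//. 
by congr (_ - _)%E; apply: eq_integral => p _; rewrite ?funeposE ?funenegE.
Qed.

Lemma integrable_nintS m (h : borel 'rV[R]_m.+1 -> \bar R) :
  (nint_measure m.+1).-integrable setT h ->
  (@lebesgue_measure R \x nint_measure m)%E.-integrable setT (fun p => h (scons p)).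
Proof.
move=> /integrableP[mh hoo]; apply/integrableP; split; first exact: measurable_slice.
by rewrite -(ge0_integral_nintS (h := fun x => `|h x|%E))//; exact: measurableT_comp.
Qed.

Definition cube n (a : 'rV[R]_n) (r : R) : set 'rV[R]_n :=
  [set x | forall k, a 0 k - r <= x 0 k <= a 0 k + r].

Lemma closed_cube n (a : 'rV[R]_n) r : closed (cube a r).
Proof.
rewrite (_ : cube a r = \bigcap_k ((fun x : 'rV[R]_n => x 0 k) @^-1` `[a 0 k - r,
  a 0 k + r])).
  apply: closed_bigI => k _; apply: preimage_closed; first by move=> x _;
    exact: coord_continuous.
  exact: interval_closed.
apply/seteqP; split=> x /= xc k; first by move=> _ /=; rewrite in_itv/=; exact: xc.
by have := xc k I; rewrite /= in_itv.
Qed.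

Lemma measurable_cube n (a : 'rV[R]_n) r : measurable
  (cube a r : set (borel 'rV[R]_n)).
Proof. by apply: measurable_closed; exact: closed_cube. Qed.

Lemma nint_measure_cube n (a : 'rV[R]_n) (r : R) : 0 <= r ->
  nint_measure n (cube a r) = ((r *+ 2) ^+ n)%:E.
Proof.
move=> r0.
have mi k (b : 'rV[R]_k) : measurable_fun setT
    (fun x : borel 'rV[R]_k => (\1_(cube b r) x : R)%:E).
  by apply/measurable_EFinP; apply: measurable_indic; exact: measurable_cube.
have i0 k (b : 'rV[R]_k) (x : borel 'rV[R]_k) : (0 <= (\1_(cube b r) x : R)%:E)%E.
  by rewrite lee_fin.
elim: n a => [a|m IH a].
  have := integral_nint0 (mi _ a) (i0 _ a).
  rewrite integral_indic ?setIT//; last exact: measurable_cube.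
  by move=> ->; rewrite indicE mem_set// => -[].
pose I := `[a 0 0 - r, a 0 0 + r]%classic.
pose a' : 'rV[R]_m := \row_k a 0 (lift 0 k).
have := ge0_integral_nintS (mi _ a) (i0 _ a).
rewrite integral_indic ?setIT//; last exact: measurable_cube.
move=> ->.
under eq_integral => p _.
  rewrite (_ : \1_(cube a r) (scons p) = \1_(I `*` cube a' r) p :> R); last first.
    rewrite !indicE; congr ((_ : bool)%:R); case: p => t y.
    apply/idP/idP; rewrite !inE /=.
      move=> c; split; first by have := c 0; rewrite scons0 /I/= in_itv.
      by move=> k; have := c (lift 0 k); rewrite scons_cont mxE.
    move=> [It yc] k; have [j ->|->] := unliftP 0 k.
      by rewrite scons_cont; have := yc j; rewrite mxE.
    by rewrite scons0; move: It; rewrite /I/= in_itv.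
  over.
have mI : measurable (I : set (measurableTypeR R)) by exact: measurable_itv.
have mc := measurable_cube a' r.
rewrite integral_indic ?setIT//; last exact: measurableX.
transitivity (lebesgue_measure I * nint_measure m (cube a' r))%E.
  exact: product_measure1E.
rewrite IH lebesgue_measure_itv/= lte_fin.
case: ifPn => [_|].
  by rewrite -EFinB exprS EFinM; congr (_%:E * _)%E; rewrite mulr2n; lra.
rewrite -leNgt => r0'; have -> : r = 0 by lra.
by rewrite mul0e mul0rn expr0n.
Qed.

Lemma compact_cube n (a : 'rV[R]_n) r : compact (cube a r).
Proof.
have -> : cube a r = [set x | forall k, `[a 0 k - r, a 0 k + r]%classic (x 0 k)].
  by apply/seteqP; split => x /= xc k; have := xc k; rewrite in_itv.
by apply: (@rV_compact R n (fun k => `[a 0 k - r, a 0 k + r]%classic)) => k;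
  exact: segment_compact.
Qed.

Lemma compact_bounded_fun (T : topologicalType) (f : T -> R) (K : set T) :
  compact K -> (forall x, K x -> {for x, continuous f}) ->
  exists2 B, 0 <= B & forall x, K x -> `|f x| <= B.
Proof.
move=> cK fc; have [K0|/set0P[x0 Kx0]] := eqVneq K set0.
  by exists 0 => // x; rewrite K0.
have [||c _ cP] := @compact_EVT_max T R (fun x => `|f x|) K _ cK.
- by exists x0.
- apply: continuous_in_subspaceT => x /set_mem Kx.
  exact: (@continuous_comp _ _ _ f (fun y : R => `|y|) x (fc x Kx)
    (@norm_continuous R R (f x))).
by exists `|f c| => // x Kx; apply: cP; exact: mem_set.
Qed.

Lemma integrable_compact_support n (h : 'rV[R]_n -> R) (r : R) :
  continuous h -> 0 <= r -> (forall x, ~ cube 0 r x -> h x = 0) ->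
  (nint_measure n).-integrable setT (EFin \o (h : borel 'rV[R]_n -> R)).
Proof.
move=> hc r0 h0.
have mh : measurable_fun setT (h : borel 'rV[R]_n -> R).
  by apply: continuous_borel_measurable; [exact: openT|move=> x _; exact: hc].
have [B B0 hB] := compact_bounded_fun (@compact_cube n 0 r) (fun x _ => hc x).
have mc := measurable_cube (0 : 'rV[R]_n) r.
rewrite (_ : EFin \o h = (EFin \o h) \_ (cube 0 r)); last first.
  apply/funext => x; rewrite patchE; case: ifPn => // /negP xc.
  by rewrite /= h0// => /mem_set.
rewrite -integrable_mkcond//.
have fin : (nint_measure n (cube (0 : 'rV[R]_n) r) < +oo)%E.
  by rewrite nint_measure_cube// ltry.
apply: (measurable_bounded_integrable mc fin).
- exact: measurable_funTS.
- exists B; split; first exact: ger0_real.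
  by move=> x /ltW Bx y /hB /le_trans; apply.
Qed.

Lemma integral_deriv_compact_support (f f' : R -> R) (r : R) : 0 < r ->
  (forall t : R, is_derive t 1 f (f' t)) -> continuous f' ->
  (forall t : R, r <= `|t| -> f t = 0) ->
  (\int[@lebesgue_measure R]_t (f' t)%:E = 0)%E.
Proof.
move=> r0 fd fc f0.
have f'0 (t : R) : r < `|t| -> f' t = 0.
  move=> rt; have [_ <-] := fd t; rewrite -(@derive_cst R R R 0 t 1).
  apply: near_eq_derive.
  near=> s; rewrite f0//= ltW//; near: s.
  exact: (@norm_continuous R R t) (open_nbhs_nbhs (conj (@open_gt R r) rt)).
rewrite [LHS](_ : _ = \int[@lebesgue_measure R]_(t in `[(- (r + 1))%R, (r + 1)%R])
  (f' t)%:E)%E; last first.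
  rewrite [RHS]integral_mkcond; apply: eq_integral => t _; rewrite patchE.
  case: ifPn => // /negP tI; rewrite f'0// ltNge; apply/negP => tr.
  by apply: tI; apply/mem_set; rewrite /= in_itv/= -ler_norml (le_trans tr)// lerDl.
have fcont : continuous f by move=> t;
  have [/derivable1_diffP/differentiable_continuous] := fd t.
rewrite (@continuous_FTC2 _ f' f).
- rewrite !f0 ?subee//.
  + by rewrite ?normrN ger0_norm; lra.
  + by rewrite ?normrN ger0_norm; lra.
- by lra.
- exact: continuous_subspaceT.
- split=> [t _||]; first by have [] := fd t.
  + exact: cvg_at_right_filter (fcont _).
  + exact: cvg_at_left_filter (fcont _).
- by move=> t _; rewrite derive1E; have [_] := fd t.
Unshelve. all: by end_near. Qed.

End nint_theory.

(** * The divergence theorem on R^n *)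

Section divergence.
Context {R : realType}.

Lemma partial_coord n (k i : 'I_n) (x : 'rV[R]_n) :
  partial k (fun y : 'rV[R]_n => y 0 i) x = (k == i)%:R.
Proof.
have := @derive_mx R 'rV[R]_n 1 n id x (delta_mx 0 k) (@derivable_id _ _ _ _).
by rewrite derive_id => /matrixP/(_ 0 i); rewrite !mxE eqxx/= eq_sym.
Qed.

Lemma C1on_coord n (U : set 'rV[R]_n) (i : 'I_n) : C1on U (fun x => x 0 i).
Proof.
move=> x _; split; first exact: differentiable_coord.
move=> k; rewrite (_ : partial k _ = cst (k == i)%:R); first exact: cst_continuous.
by apply/funext => y; rewrite partial_coord.
Qed.

Lemma scons_line m (t : R) (y : 'rV[R]_m) :
  scons (t, y) = scons (0 : R, y) + t *: (delta_mx 0 0 : 'rV[R]_m.+1).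
Proof.
apply/rowP => k; rewrite [RHS]mxE [X in _ + X]mxE [X in _ + _ * X]mxE eqxx/=.
have [j ->|->] := unliftP 0 k.
  by rewrite !scons_cont [lift 0 j == 0]eq_sym (negbTE (neq_lift 0 j)) mulr0 addr0.
by rewrite !scons0 eqxx mulr1 add0r.
Qed.

Lemma scons_addr m (t : R) (y z : 'rV[R]_m) (j : 'I_m) (s : R) :
  scons (t, s *: (delta_mx 0 j : 'rV[R]_m) + y) =
  s *: (delta_mx 0 (lift 0 j) : 'rV[R]_m.+1) + scons (t, y).
Proof.
apply/rowP => k; rewrite [RHS]mxE; have [i ->|->] := unliftP 0 k.
  by rewrite !scons_cont !mxE eqxx/= (inj_eq lift_inj).
by rewrite !scons0 !mxE eqxx/= ?(negbTE (neq_lift 0 j)) mulr0 add0r.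
Qed.

Lemma partial_slice m (w : 'rV[R]_m.+1 -> R) (t : R) (j : 'I_m) (y : 'rV[R]_m) :
  partial (lift 0 j) w (scons (t, y)) =
  partial j (fun z : 'rV[R]_m => w (scons (t, z))) y.
Proof.
rewrite /partial /derive.
set F := (X in lim (X @ _)); set G := (X in _ = lim (X @ _)).
suff -> : F = G by [].
by apply/funext => h; rewrite /F /G /= scons_addr.
Qed.

(* The fundamental theorem of calculus in the first variable after exchanging
   the order of integration; the other variables are reached by induction,
   slice by slice. *)
Lemma integral_partial_eq0 n (w : 'rV[R]_n -> R) (r : R) (k : 'I_n) :
  C1on setT w -> 0 < r -> (forall x, ~ cube 0 r x -> w x = 0) ->
  (\int[nint_measure n]_x (partial k w x)%:E = 0)%E.
Proof.
elim: n w k => [w []//|m IH w k wC r0 w0].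
have pc : continuous (partial k w) by move=> x; have [_ wc] := wC x I; exact: wc.
have p0 x : ~ cube 0 r x -> partial k w x = 0.
  move=> xr; rewrite -(partial_cst 0 k x); apply: near_eq_partial.
  apply: filterS (open_nbhs_nbhs (conj (closed_openC (@closed_cube R m.+1 0 r)) xr))
    => y.
  exact: w0.
have pint := integrable_compact_support pc (ltW r0) p0.
have mp : measurable_fun setT (EFin \o (partial k w : borel 'rV[R]_m.+1 -> R)).
  exact: measurable_int pint.
rewrite (integral_nintS mp); have sint := integrable_nintS pint.
have cscons x : cube 0 r x <->
  - r <= x 0 0 <= r /\ cube 0 r (\row_j x 0 (lift 0 j) : 'rV[R]_m).
  split=> [xc|[x0 xc] j].
    split; first by have := xc 0; rewrite mxE sub0r add0r.
    by move=> j; have := xc (lift 0 j); rewrite !mxE.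
  rewrite mxE sub0r add0r; have [i ->|->//] := unliftP 0 j.
  by have := xc i; rewrite !mxE sub0r add0r.
have [j kE|kE] := unliftP 0 k.
  rewrite -integral12_prod_meas1//; apply: integral0_eq => t _; rewrite /fubini_F.
  pose wt (y : 'rV[R]_m) := w (scons (t, y)).
  rewrite (eq_integral (fun y : borel 'rV[R]_m => (partial (j : 'I_m) wt y)%:E));
    last first.
    by move=> y _; rewrite kE; congr EFin; exact: partial_slice.
  apply: IH => //.
    apply: (@C1on_comp R m m.+1 (fun y => scons (t, y)) setT setT) => //;
      first exact: openT.
    move=> l; have [i ->|->] := unliftP 0 l.
      rewrite (_ : (fun y => _) = (fun y : 'rV[R]_m => y 0 i)).
        exact: C1on_coord.
      by apply/funext => y; rewrite scons_cont.
    rewrite (_ : (fun y => _) = cst t); first by move=> ? ?; exact: C1on_cst.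
    by apply/funext => y; rewrite scons0.
  move=> y yc; apply: w0 => /cscons[_ yc']; apply: yc => i.
  by have := yc' i; rewrite [X in _ <= X <= _]mxE scons_cont.
rewrite -integral21_prod_meas1//; apply: integral0_eq => y _; rewrite /fubini_G.
(* The radius grows to r + 1 because w is known to vanish only strictly outside the closed cube,
   while the one-variable lemma wants zeros from its radius on. *)
apply: (@integral_deriv_compact_support R (fun t => w (scons (t, y))) (fun t =>
  partial k w (scons (t, y))) (r + 1)).
- by rewrite addr_gt0.
- move=> t.
  have -> : (fun t : R => w (scons (t, y))) =
      (fun s : R => w (scons (0, y) + s *: delta_mx 0 0)).
    by apply/funext => s; rewrite -scons_line.
  rewrite kE (scons_line t y) /partial; apply: (@is_derive_line R m.+1 w).
  by apply: diff_derivable;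
    case: (wC (scons (0 : R, y) + t *: (delta_mx 0 0 : 'rV[R]_m.+1)) I).
- move=> t; apply: (@continuous_comp _ _ _ (fun t => scons (t, y)) (partial k w))
  (pc _).
  rewrite (_ : (fun t => _) = (fun s : R => scons (0, y) + s *: delta_mx 0 0));
    last first.
    by apply/funext => s; rewrite scons_line.
  apply: (@continuousD R 'rV[R]_m.+1); first exact: cst_continuous.
  exact: scalel_continuous.
- move=> t rt; apply: w0 => /cscons[+ _]; rewrite scons0 -ler_norml.
  by apply/negP; rewrite -ltNge (lt_le_trans _ rt)// ltrDl.
Qed.
End divergence.

(** * Bump functions on cubes *)

Section bump.
Context {R : realType}.

(* C^1 bumps suffice: Green's identity differentiates the test function once. *)
Definition pos2 (s : R) : R := Num.max 0 s ^+ 2.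

Lemma is_derive_pos2 (s : R) : is_derive s 1 pos2 (2 * Num.max 0 s).
Proof.
have [s0|s0|s0] := ltgtP s 0.
- apply: (@near_eq_is_derive _ _ _ (cst 0)).
    near=> t; rewrite /pos2 max_l ?expr0n// ltW//; near: t.
    exact: (open_nbhs_nbhs (conj (@open_lt R 0) s0)).
  by rewrite mulr0; exact: is_derive_cst.
- apply: (@near_eq_is_derive R R R (fun t : R => t ^+ 2)).
    near=> t; rewrite /pos2 max_r// ltW//; near: t.
    exact: (open_nbhs_nbhs (conj (@open_gt R 0) s0)).
  by rewrite -[_ * _]mulr1; exact: (@is_deriveX R R id 2 s 1 1 (is_derive_id _ _)).
rewrite s0 mulr0.
(* At 0 one has 0 <= pos2 h <= h^2, so the difference quotient is at most |h| in absolute value. *)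
have L : (fun h : R => h^-1 *: ((pos2 \o shift 0) (h *: 1) - pos2 0)) @ 0^' -->
  (0 : R).
  apply/cvgrPdist_le => e e0; near=> h.
  rewrite sub0r normrN /= [h *: 1]mulr1 addr0 /pos2 maxxx expr0n subr0.
  have h0 : h != 0 by near: h; exact: nbhs_dnbhs_neq.
  rewrite normrM normfV ler_pdivrMl ?normr_gt0// normrX expr2 ler_pM//.
    by rewrite ger0_norm ?le_max ?lexx// ge_max normr_ge0 ler_norm.
  apply: (@le_trans _ _ `|h|).
    by rewrite ger0_norm ?le_max ?lexx// ge_max normr_ge0 ler_norm.
  by near: h; exact: dnbhs0_le.
split; first by apply/cvg_ex; exists 0.
exact: cvg_lim L.
Unshelve. all: by end_near. Qed.

(** For r > 0 the k-th factor is positive exactly when |x_k - a_k| < r, so the product is positive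
    exactly on the open cube. *)
Definition cube_bump n (a : 'rV[R]_n) (r : R) (x : 'rV[R]_n) : R :=
  \prod_k pos2 (r ^+ 2 - (x 0 k - a 0 k) ^+ 2).

Lemma cube_bump_ge0 n (a : 'rV[R]_n) r x : 0 <= cube_bump a r x.
Proof. by apply: prodr_ge0 => k _; exact: sqr_ge0. Qed.

Lemma cube_bump_gt0 n (a : 'rV[R]_n) r : 0 < r -> 0 < cube_bump a r a.
Proof.
move=> r0; apply: prodr_gt0 => k _.
by rewrite /pos2 subrr expr0n subr0 exprn_gt0// lt_max exprn_gt0 ?orbT.
Qed.

Lemma cube_bump_eq0 n (a : 'rV[R]_n) r x : 0 < r -> ~ cube a r x -> cube_bump a r x
  = 0.
Proof.
move=> r0 /existsNP[k xk]; apply/eqP; rewrite prodf_seq_eq0; apply/hasP; exists k.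
  by rewrite mem_index_enum.
have rx : r < `|x 0 k - a 0 k|.
  by rewrite ltNge; apply/negP => xa; apply: xk; rewrite -ler_distl.
rewrite /= /pos2 max_l ?expr0n// subr_le0 -[leRHS]real_normK ?num_real//.
by rewrite ltW// ltrXn2r// ?nnegrE ltW.
Qed.

Lemma C1on_cube_bump n (a : 'rV[R]_n) r : C1on setT (cube_bump a r).
Proof.
apply: C1on_prod => [|k]; first exact: openT.
apply: (@C1on_comp1 R n setT (fun x => r ^+ 2 - (x 0 k - a 0 k) ^+ 2) pos2
  (fun s => 2 * Num.max 0 s)); first exact: openT.
- apply: C1onD; [exact: openT|exact: C1on_cst|apply: C1onN => //; first exact: openT].
  apply: C1onX; first exact: openT.
  by apply: C1onD; [exact: openT|exact: C1on_coord|exact: C1on_cst].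
- by move=> x _; exact: is_derive_pos2.
move=> x _; apply: (@continuousM R); first exact: cst_continuous.
apply: (@continuous_max R R (cst 0) id); first exact: cst_continuous.
by move=> A.
Qed.

End bump.

(** * Riemannian geometry in charts *)

(* The determinant does not vanish along the segment from 1 to G, all of whose
   points are positive definite. *)
Lemma det_posdef_gt0 (R : realType) n (G : 'M[R]_n) :
  (forall v : 'rV[R]_n, v != 0 -> 0 < (v *m G *m v^T) 0 0) -> 0 < \det G.
Proof.
move=> Gpos; rewrite ltNge; apply/negP => G0.
pose F (t : R) := t *: G + (1 - t) *: 1%:M.
pose f (t : R) := \det (F t).
have fc : continuous f.
  move=> t; apply: continuous_sumr => s; apply: (@continuousM R).
    exact: cst_continuous.
  apply: continuous_prodr => k.
  rewrite (_ : (fun y => _) = (fun y : R => y * G k ((s : {perm 'I_n}) k) +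
    (1 - y) * 1%:M k ((s : {perm 'I_n}) k))).
    by apply: (@continuousD R); apply: (@continuousM R); try exact: cst_continuous;
      [move=> ?|apply: (@continuousB R); [exact: cst_continuous|move=> ?]].
  by apply/funext => y; rewrite !mxE.
have f0 : f 0 = 1 by rewrite /f /F scale0r add0r subr0 scale1r det1.
have f1 : f 1 = \det G by rewrite /f /F scale1r subrr scale0r addr0.
have [||c c01] := @IVT R f 0 1 0 ler01.
- exact: continuous_subspaceT.
- by rewrite f0 f1 ge_min le_max ler01 G0 orbT.
move=> /eqP/det0P[v v0 vF].
have : 0 < (v *m F c *m v^T) 0 0.
  have vv : 0 < (v *m v^T) 0 0.
    have [k vk] : exists k, v 0 k != 0 by apply/rV0Pn.
    rewrite mxE (bigD1 k)//= ltr_pwDl//.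
      by rewrite !mxE -expr2 exprn_even_gt0.
    by apply: sumr_ge0 => j _; rewrite !mxE -expr2 sqr_ge0.
  have vG := Gpos _ v0.
  rewrite mulmxDr mulmxDl mxE -!scalemxAr -!scalemxAl mulmx1 mxE [X in _ + X]mxE.
  move: c01; rewrite in_itv/= => /andP[c0 c1].
  have [c0'|c0'] := eqVneq c 0.
    by rewrite c0' mul0r add0r subr0 mul1r.
  apply: ltr_pwDl; first by apply: mulr_gt0 => //; rewrite lt0r c0'.
  by apply: mulr_ge0; [rewrite subr_ge0|exact: ltW].
by rewrite vF mul0mx mxE ltxx.
Qed.

(** * The volume measure in a chart *)

Section volume.
Context {R : realType} {n : nat} {M : ptopologicalType}.
Context {A : smooth_atlas R n M} (g : riemannian_metric A).
Context (dV : {measure set (borel M) -> \bar R}).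
Hypothesis dVE : riemannian_volume g dV.
Implicit Types (i j : chart A) (p : M) (x : 'rV[R]_n).

Lemma open_cod i : open (cod i). Proof. exact: cod_open. Qed.

Lemma open_dom i : open (dom i). Proof. exact: dom_open. Qed.

Lemma psiK i x : cod i x -> dom i (psi i x) /\ phi i (psi i x) = x.
Proof. by move=> [p ip <-]; rewrite phiK// inE. Qed.

Lemma cod_phi i p : dom i p -> cod i (phi i p).
Proof. by move=> ip; exists p. Qed.

Lemma phi_psi i p : dom i p -> psi i (phi i p) = p.
Proof. by move=> ip; rewrite phiK// inE. Qed.

Lemma gram_det_gt0 i x : cod i x -> 0 < \det (gram g i x).
Proof. by move=> ix; apply: det_posdef_gt0 => v v0; exact: gram_pos. Qed.

Lemma C1on_sqrt_det i : C1on (cod i) (sqrt_det g i).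
Proof.
have oc := @open_cod i.
apply: C1on_sqrt => //; last by move=> x; exact: gram_det_gt0.
by apply: C1on_det => // k l; apply: smooth_C1on => //; exact: gram_smooth.
Qed.

Lemma sqrt_det_gt0 i x : cod i x -> 0 < sqrt_det g i x.
Proof. by move=> /gram_det_gt0; rewrite sqrtr_gt0. Qed.

Lemma sqrt_det_ge0 i x : 0 <= sqrt_det g i x.
Proof. exact: sqrtr_ge0. Qed.

Lemma open_psi_preimage i (V : set M) : open V -> open (cod i `&` psi i @^-1` V).
Proof.
move=> oV; rewrite openE => x [ix Vx]; apply: filterI.
  exact: open_nbhs_nbhs (conj (@open_cod i) ix).
have := @psi_continuous _ _ _ A i x; rewrite inE => /(_ ix); apply.
exact: open_nbhs_nbhs.
Qed.

Lemma measurable_dom i : measurable (dom i : set (borel M)).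
Proof. exact: measurable_open (@open_dom i). Qed.

Lemma measurable_cod i : measurable (cod i : set (borel 'rV[R]_n)).
Proof. exact: measurable_open (@open_cod i). Qed.

Local Hint Resolve measurable_dom measurable_cod : core.

Lemma measurable_psi i :
  measurable_fun (cod i : set (borel 'rV[R]_n)) (psi i : borel 'rV[R]_n -> borel M).
Proof.
apply: (@measurability _ _ (borel 'rV[R]_n) (borel M) (cod i) (psi i) (@open M)
  erefl).
by move=> _ [V oV <-]; apply: measurable_open; exact: open_psi_preimage.
Qed.

Lemma measurable_sqrt_det i :
  measurable_fun (cod i : set (borel 'rV[R]_n)) (sqrt_det g i : borel 'rV[R]_n -> R).
Proof.
apply: continuous_borel_measurable; first exact: open_cod.
by move=> x ix; exact: C1on_continuous (@C1on_sqrt_det i) ix.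
Qed.

Lemma measurable_density i (h : borel M -> R) : measurable_fun setT h ->
  measurable_fun (cod i : set (borel 'rV[R]_n))
    (fun x => (sqrt_det g i x * h (psi i x))%:E).
Proof.
move=> mh; apply/measurable_EFinP; apply: measurable_funM.
  exact: measurable_sqrt_det.
by apply: measurableT_comp mh _; exact: measurable_psi.
Qed.

Let integral_chart_indic i (B : set (borel M)) : measurable B ->
  (\int[dV]_(p in dom i) (\1_B p)%:E =
   \int[nint_measure n]_(x in cod i) (sqrt_det g i x * \1_B (psi i x))%:E)%E.
Proof.
move=> mB; rewrite integral_indic//.
have -> := dVE (measurableI _ _ mB (measurable_dom i)) (@subIsetr _ B (dom i)).
(* The indicator of the image kills the junk values of the density outside [cod i]. The integrand is
   thus Borel on all of R^n, as the passage to [nint_measure] requires. *)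
have E : (fun x => (sqrt_det g i x * \1_(phi i @` (B `&` dom i)) x)%:E) =
    ((fun x => (sqrt_det g i x * \1_B (psi i x))%:E) \_ (cod i) : 'rV[R]_n -> \bar R).
  apply/funext => x; rewrite patchE; case: ifPn => [/set_mem ix|/negP ix].
    congr (_ * _)%:E; rewrite !indicE; congr (_ : bool)%:R.
    apply/idP/idP; rewrite !inE; first by move=> [p [Bp ip] <-]; rewrite phi_psi.
    by move=> Bx; exists (psi i x); have [? ?] := psiK ix.
  rewrite indicE (_ : _ \in _ = false) ?mulr0//.
  by apply/negP; rewrite inE => -[p [_ ip] px]; apply: ix; rewrite inE -px;
    exact: cod_phi.
rewrite E integral_mkcond; apply: nint_measureE.
  apply/(measurable_restrictT _ _).1 => //.
  by apply: measurable_density; exact: measurable_indic.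
move=> x; rewrite patchE; case: ifPn => // _.
by rewrite lee_fin mulr_ge0// sqrt_det_ge0.
Qed.

Import HBNNSimple.

Let integral_chart_nnsfun i (f : {nnsfun borel M >-> R}) :
  (\int[dV]_(p in dom i) (f p)%:E =
   \int[nint_measure n]_(x in cod i) (sqrt_det g i x * f (psi i x))%:E)%E.
Proof.
have mk k : measurable (f @^-1` [set k]) by exact: measurable_sfunP.
have mi k : measurable_fun setT (\1_(f @^-1` [set k]) : borel M -> R).
  exact: measurable_indic.
have sk k x : (0 <= (sqrt_det g i x * (k * \1_(f @^-1` [set k]) (psi i x)))%:E)%E.
  by rewrite lee_fin mulr_ge0 ?sqrt_det_ge0// -lee_fin EFinM nnfun_muleindic_ge0.
transitivity (\sum_(k \in range f)
    \int[dV]_(p in dom i) (k * \1_(f @^-1` [set k]) p)%:E)%E.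
  under eq_integral do rewrite fimfunE -fsumEFin//.
  rewrite ge0_integral_fsum//.
  - by move=> k; apply/measurable_EFinP; apply: measurable_funM => //;
    exact: measurable_funTS.
  - by move=> k p _; rewrite EFinM nnfun_muleindic_ge0.
transitivity (\sum_(k \in range f)
    \int[nint_measure n]_(x in cod i)
      (sqrt_det g i x * (k * \1_(f @^-1` [set k]) (psi i x)))%:E)%E; last first.
  rewrite -ge0_integral_fsum//; last first.
    move=> k; apply: (@measurable_density i (fun p => k * \1_(f @^-1` [set k]) p)).
    exact: measurable_funM.
  apply: eq_integral => x _; rewrite fimfunE fsumEFin//; congr EFin.
  rewrite !fsbig_finite//= mulr_sumr//.
apply: eq_fsbigr => k /set_mem[p _ <-].
have k0 : 0 <= f p by exact: fun_ge0.
transitivity ((f p)%:E * \int[dV]_(q in dom i) (\1_(f @^-1` [set f p]) q)%:E)%E.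
  rewrite -ge0_integralZl_EFin//.
  - by apply/measurable_EFinP; exact: measurable_funTS.
rewrite integral_chart_indic// -ge0_integralZl_EFin//.
- by apply: eq_integral => x _; rewrite -EFinM mulrCA.
- by move=> x _; rewrite lee_fin mulr_ge0// sqrt_det_ge0.
- by apply: measurable_density; exact: measurable_indic.
Qed.

(** [riemannian_volume] gives the formula for indicators; finite sums extend it to simple functions,
    and monotone convergence to all nonnegative measurable ones. *)
Lemma ge0_integral_chart i (h : borel M -> R) : measurable_fun setT h ->
  (forall p, 0 <= h p) ->
  (\int[dV]_(p in dom i) (h p)%:E =
   \int[nint_measure n]_(x in cod i) (sqrt_det g i x * h (psi i x))%:E)%E.
Proof.
move=> mh h0.
have mE : measurable_fun setT (EFin \o h) by exact/measurable_EFinP.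
pose f_ := nnsfun_approx measurableT mE.
transitivity (limn (fun k => \int[dV]_(p in dom i) (f_ k p)%:E)%E).
  rewrite -monotone_convergence//.
  - apply: eq_integral => p _; apply/esym/cvg_lim => //.
    by apply: (cvg_nnsfun_approx measurableT mE) => // *; rewrite lee_fin.
  - by move=> k; exact/measurable_EFinP/measurable_funTS.
  - by move=> k p _; rewrite lee_fin.
  - by move=> p _ k l kl; rewrite lee_fin; exact/lefP/nd_nnsfun_approx.
under eq_fun do rewrite integral_chart_nnsfun.
rewrite -monotone_convergence//.
- apply: eq_integral => x _; apply/cvg_lim => //.
  under eq_fun do rewrite EFinM.
  rewrite EFinM; apply: cvgeZl => //.
  by apply: (cvg_nnsfun_approx measurableT mE) => // *; rewrite lee_fin.
- by move=> k; apply: measurable_density.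
- by move=> k x _; rewrite lee_fin mulr_ge0// sqrt_det_ge0.
- move=> x _ k l kl; rewrite lee_fin; apply: ler_wpM2l; first exact: sqrt_det_ge0.
  by have /lefP := nd_nnsfun_approx measurableT mE kl; exact.
Qed.

End volume.

(** * Differentials and gradients under change of chart *)

Section geometry.
Context {R : realType} {n : nat} {M : ptopologicalType}.
Context {A : smooth_atlas R n M} (g : riemannian_metric A).
Implicit Types (i j : chart A) (p : M) (x : 'rV[R]_n) (u v : M -> R).

Definition C1M u := forall i : chart A, C1on (cod i) (u \o psi i).

Lemma smooth_C1M u : smooth (A := A) u -> C1M u.
Proof. by move=> us i; apply: smooth_C1on; [exact: open_cod|exact: us]. Qed.

Lemma near_chart i p (Q : set 'rV[R]_n) : dom i p ->
  (\forall x \near phi i p, Q x) -> \forall q \near p, dom i q /\ Q (phi i q).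
Proof.
move=> ip Qx; apply: filterI; first exact: open_nbhs_nbhs
  (conj (@open_dom _ _ _ _ i) ip).
have := @phi_continuous _ _ _ A i p; rewrite inE => /(_ ip); exact.
Qed.

Lemma continuous_from_chart i p (F : 'rV[R]_n -> R) u : dom i p ->
  {for phi i p, continuous F} -> (forall q, dom i q -> u q = F (phi i q)) ->
  {for p, continuous u}.
Proof.
move=> ip Fc uF; rewrite /prop_for /continuous_at uF//.
apply: (@near_eq_cvg_to _ _ (F \o phi i)).
  by apply: filterS (open_nbhs_nbhs (conj (@open_dom _ _ _ _ i) ip)) => q /uF.
apply: continuous_comp => //.
by have := @phi_continuous _ _ _ A i p; rewrite inE => /(_ ip).
Qed.

Lemma C1M_continuous u : C1M u -> continuous u.
Proof.
move=> uC p; have [i ip] := dom_cover A p.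
apply: (continuous_from_chart ip (F := u \o psi i)).
  exact: C1on_continuous (uC i) (cod_phi ip).
by move=> q iq /=; rewrite phi_psi.
Qed.

Lemma C1M_cst (c : R) : C1M (fun=> c).
Proof. by move=> i; exact: C1on_cst. Qed.

Lemma C1MD u v : C1M u -> C1M v -> C1M (fun p => u p + v p).
Proof. by move=> uC vC i; exact: (C1onD (@open_cod _ _ _ _ i) (uC i) (vC i)). Qed.

Lemma C1MN u : C1M u -> C1M (fun p => - u p).
Proof. by move=> uC i; exact: (C1onN (@open_cod _ _ _ _ i) (uC i)). Qed.

Lemma C1MM u v : C1M u -> C1M v -> C1M (fun p => u p * v p).
Proof. by move=> uC vC i; exact: (C1onM (@open_cod _ _ _ _ i) (uC i) (vC i)). Qed.

Lemma C1MV u : C1M u -> (forall p, u p != 0) -> C1M (fun p => (u p)^-1).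
Proof.
by move=> uC u0 i; apply: (C1onV (@open_cod _ _ _ _ i) (uC i)) => x _; exact: u0.
Qed.

Lemma C1M_sum (I : Type) (r : seq I) (F : I -> M -> R) :
  (forall k, C1M (F k)) -> C1M (fun p => \sum_(k <- r) F k p).
Proof.
move=> FC i; exact: (C1on_sum r (@open_cod _ _ _ _ i) (fun k => FC k i)).
Qed.

Definition dchart i u x : 'rV[R]_n := \row_k partial k (u \o psi i) x.

Lemma dchartM i u v x : C1M u -> C1M v -> cod i x ->
  dchart i (fun p => u p * v p) x =
  u (psi i x) *: dchart i v x + v (psi i x) *: dchart i u x.
Proof.
move=> uC vC ix; apply/rowP => k; rewrite !mxE.
exact: (partialM k (proj1 (uC i x ix)) (proj1 (vC i x ix))).
Qed.

Lemma dchartD i u v x : C1M u -> C1M v -> cod i x ->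
  dchart i (fun p => u p + v p) x = dchart i u x + dchart i v x.
Proof.
move=> uC vC ix; apply/rowP => k; rewrite !mxE.
exact: (partialD k (proj1 (uC i x ix)) (proj1 (vC i x ix))).
Qed.

Lemma dchart_cst i (c : R) x : dchart i (fun=> c) x = 0.
Proof. by apply/rowP => k; rewrite !mxE partial_cst. Qed.

Lemma gram_unit i x : cod i x -> gram g i x \in unitmx.
Proof. by move=> ix; rewrite unitmxE unitfE gt_eqF// gram_det_gt0. Qed.

Lemma invmx_gram_sym i x : cod i x -> (invmx (gram g i x))^T = invmx (gram g i x).
Proof. by move=> ix; rewrite trmx_inv gram_sym. Qed.

Lemma gradE i u x : cod i x -> grad g i u x = dchart i u x *m invmx (gram g i x).
Proof.
move=> ix; apply/rowP => k; rewrite !mxE; apply: eq_bigr => l _.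
by rewrite -{1}(invmx_gram_sym ix) !mxE mulrC.
Qed.

Lemma inner_grad_dchart i u v p : dom i p ->
  inner_grad g i u v p =
  (dchart i u (phi i p) *m invmx (gram g i (phi i p)) *m (dchart i v (phi i p))^T) 0
    0.
Proof.
move=> ip; have ix := cod_phi ip.
rewrite /inner_grad !gradE// mulmxKV ?gram_unit//.
by rewrite trmx_mul invmx_gram_sym// mulmxA.
Qed.

Lemma inner_grad_sum i u v p : dom i p ->
  inner_grad g i u v p =
  \sum_k partial k (u \o psi i) (phi i p) * grad g i v (phi i p) 0 k.
Proof.
move=> ip; have ix := cod_phi ip.
rewrite inner_grad_dchart// -mulmxA -[X in _ *m X]trmxK trmx_mul trmxK.
rewrite invmx_gram_sym// -gradE// mxE; apply: eq_bigr => k _.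
by rewrite [dchart _ _ _ _ _]mxE [X in _ * X]mxE.
Qed.

Lemma transition_domE i j :
  phi i @` (dom i `&` dom j) = cod i `&` psi i @^-1` (dom j).
Proof.
apply/seteqP; split=> [_ [p [ip jp] <-]|x [ix jx]].
  by split; [exact: cod_phi|rewrite /= phi_psi].
by exists (psi i x); have [? ?] := psiK ix.
Qed.

Lemma open_transition_dom i j : open (phi i @` (dom i `&` dom j)).
Proof. by rewrite transition_domE; apply: open_psi_preimage; exact: open_dom. Qed.

Lemma C1on_transition i j k :
  C1on (phi i @` (dom i `&` dom j)) (fun x => phi j (psi i x) 0 k).
Proof.
by apply: smooth_C1on; [exact: open_transition_dom|exact: transition_smooth].
Qed.

(** The chain rule. [jacobian] acts on row vectors of coordinates, so the rows of partial
    derivatives transform by its transpose, in the opposite direction. *)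
Lemma dchart_transition i j u p : C1M u -> dom i p -> dom j p ->
  dchart i u (phi i p) =
  dchart j u (phi j p) *m (jacobian (phi j \o psi i) (phi i p))^T.
Proof.
move=> uC ip jp.
have Vx : (phi i @` (dom i `&` dom j)) (phi i p) by exists p.
have Td k : differentiable (fun x => (phi j \o psi i) x 0 k) (phi i p).
  by have [] := C1on_transition k Vx.
have jE : phi j p = (phi j \o psi i) (phi i p) by rewrite /= phi_psi.
have ud : differentiable (u \o psi j) ((phi j \o psi i) (phi i p)).
  by rewrite -jE; have [] := uC j _ (cod_phi jp).
apply/rowP => k; rewrite [LHS]mxE [RHS]mxE.
transitivity (partial k ((u \o psi j) \o (phi j \o psi i)) (phi i p)).
  apply: near_eq_partial;
    apply: filterS (open_nbhs_nbhs (conj (@open_transition_dom i j) Vx)).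
  by move=> _ [q [iq jq] <-] /=; rewrite !phi_psi.
rewrite partial_comp//; apply: eq_bigr => l _.
rewrite [dchart j u _ 0 l]mxE [(_^T) l k]mxE jacobianE;
  last exact: differentiable_coords.
by rewrite -jE mulrC.
Qed.

(** With G_i = J G_j J^T, invariance amounts to J^T G_i^-1 J = G_j^-1; J is invertible because it is
    a factor of the invertible square matrix G_i. *)
Lemma inner_grad_chart i j u v p : C1M u -> C1M v -> dom i p -> dom j p ->
  inner_grad g i u v p = inner_grad g j u v p.
Proof.
move=> uC vC ip jp; rewrite !inner_grad_dchart//.
rewrite (dchart_transition uC ip jp) (dchart_transition vC ip jp).
have := gram_transition g ip jp; set J := jacobian _ _ => /= GJ.
have Gi := gram_unit (cod_phi ip); have Gj := gram_unit (cod_phi jp).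
have Ju : J \in unitmx.
  by move: Gi; rewrite GJ !unitmx_mul => /andP[/andP[]].
rewrite trmx_mul trmxK !mulmxA; congr (fun_of_matrix (_ *m _) _ _).
rewrite -!mulmxA; congr (_ *m _).
set X := LHS.
have JX : J *m (gram g j (phi j p) *m X) = J.
  by rewrite /X !mulmxA -GJ mulmxV// mul1mx.
have GX : gram g j (phi j p) *m X = 1%:M by rewrite -(mulKmx Ju (_ *m X)) JX mulVmx.
by rewrite -(mulKmx Gj X) GX mulmx1.
Qed.

Definition chart_at p : chart A := projT1 (cid (dom_cover A p)).

Lemma chart_atP p : dom (chart_at p) p.
Proof. exact: projT2 (cid (dom_cover A p)). Qed.

(* g(grad u, grad v), made a function on M by choosing a chart at each point. *)
Definition dot_grad u v p : R := inner_grad g (chart_at p) u v p.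

Lemma dot_gradE i u v p : C1M u -> C1M v -> dom i p -> dot_grad u v p =
  inner_grad g i u v p.
Proof. by move=> uC vC ip; apply: inner_grad_chart => //; exact: chart_atP. Qed.

Lemma dot_gradMl u u' v p : C1M u -> C1M u' ->
  dot_grad (fun q => u q * u' q) v p = u p * dot_grad u' v p + u' p * dot_grad u v p.
Proof.
move=> uC uC'; have ip := chart_atP p; rewrite /dot_grad !inner_grad_dchart//.
rewrite dchartM//; last exact: cod_phi.
by rewrite phi_psi// !mulmxDl -!scalemxAl !mxE.
Qed.

Lemma dot_gradDl u u' v p : C1M u -> C1M u' ->
  dot_grad (fun q => u q + u' q) v p = dot_grad u v p + dot_grad u' v p.
Proof.
move=> uC uC'; have ip := chart_atP p; rewrite /dot_grad !inner_grad_dchart//.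
rewrite dchartD//; last exact: cod_phi.
by rewrite !mulmxDl mxE.
Qed.

Lemma dot_grad_cstl (c : R) v p : dot_grad (fun=> c) v p = 0.
Proof.
have ip := chart_atP p.
by rewrite /dot_grad inner_grad_dchart// dchart_cst !mul0mx mxE.
Qed.

Lemma dot_gradNl u v p : C1M u -> dot_grad (fun q => - u q) v p = - dot_grad u v p.
Proof.
move=> uC; apply/eqP; rewrite -addr_eq0 -(dot_gradDl v p (C1MN uC) uC); apply/eqP.
rewrite -(dot_grad_cstl 0 v p); congr (dot_grad _ v p).
by apply/funext => q; rewrite addNr.
Qed.

Lemma dot_gradC u v p : dot_grad u v p = dot_grad v u p.
Proof.
have ip := chart_atP p; rewrite /dot_grad !inner_grad_dchart//.
have tr (B : 'M[R]_1) : B 0 0 = B^T 0 0 by rewrite mxE.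
by rewrite [RHS]tr !trmx_mul trmxK invmx_gram_sym ?mulmxA//; exact: cod_phi.
Qed.

Lemma dot_grad_ge0 u p : 0 <= dot_grad u u p.
Proof.
have ip := chart_atP p; rewrite /dot_grad /inner_grad.
have [->|d0] := eqVneq (grad g (chart_at p) u (phi (chart_at p) p)) 0.
  by rewrite !mul0mx mxE.
by apply/ltW/gram_pos => //; exact: cod_phi.
Qed.

Lemma dot_grad_eq0 u p : dot_grad u u p = 0 -> dchart (chart_at p) u
  (phi (chart_at p) p) = 0.
Proof.
have ip := chart_atP p; have ix := cod_phi ip; rewrite /dot_grad /inner_grad => g0.
have [/eqP|d0] := eqVneq (grad g (chart_at p) u (phi (chart_at p) p)) 0.
  rewrite gradE// =>
    /eqP/(congr1 (mulmx^~ (gram g (chart_at p) (phi (chart_at p) p)))).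
  by rewrite mulmxKV ?gram_unit// mul0mx.
by have := gram_pos g ix d0; rewrite g0 ltxx.
Qed.

Lemma dot_grad_continuous u v : C1M u -> C1M v -> continuous (dot_grad u v).
Proof.
move=> uC vC p; have [i ip] := dom_cover A p; have ix := cod_phi ip.
apply: (continuous_from_chart ip (F := fun x =>
  \sum_k partial k (u \o psi i) x *
   \sum_l invmx (gram g i x) k l * partial l (v \o psi i) x)).
  apply: continuous_sumr => k; apply: (@continuousM R).
    by have [_ uc] := uC i _ ix; exact: uc.
  apply: continuous_sumr => l; apply: (@continuousM R).
    apply: (C1on_continuous (U := cod i)) => //; apply: C1on_invmx.
    - exact: open_cod.
    - by move=> a b; apply: smooth_C1on; [exact: open_cod|exact: gram_smooth].
    - by move=> x; exact: gram_unit.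
  by have [_ vc] := vC i _ ix; exact: vc.
move=> q iq; rewrite (dot_gradE uC vC iq) inner_grad_sum//.
by apply: eq_bigr => k _; rewrite [X in _ * X]mxE.
Qed.


Lemma C1on_local (U : set 'rV[R]_n) (f : 'rV[R]_n -> R) :
  (forall x, U x -> exists V : set 'rV[R]_n, V x /\ C1on V f) -> C1on U f.
Proof. by move=> fV x /fV[V [Vx fC]]; exact: fC. Qed.

(** Outside [dom i] the value [phi i p] is junk and could fall into the cube, hence the test. *)
Definition chart_bump i (a : 'rV[R]_n) (r : R) (p : M) : R :=
  if `[< dom i p >] then cube_bump a r (phi i p) else 0.

Lemma chart_bump_in i a r p : dom i p -> chart_bump i a r p = cube_bump a r (phi i p).
Proof. by move=> ip; rewrite /chart_bump; case: asboolP. Qed.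

Lemma chart_bump_ge0 i a r p : 0 <= chart_bump i a r p.
Proof. by rewrite /chart_bump; case: asboolP => // _; exact: cube_bump_ge0. Qed.

Lemma chart_bump_supp i a r p : 0 < r -> cube a r `<=` cod i ->
  ~ (psi i @` cube a r) p -> chart_bump i a r p = 0.
Proof.
move=> r0 ac pK; rewrite /chart_bump; case: asboolP => // ip.
by apply: cube_bump_eq0 => // xc; apply: pK; exists (phi i p) => //; rewrite phi_psi.
Qed.

Lemma compact_psi_cube i a r : cube a r `<=` cod i -> compact (psi i @` cube a r).
Proof.
move=> ac; apply: continuous_compact; last exact: compact_cube.
apply: continuous_in_subspaceT => x /set_mem/ac ix.
by have := @psi_continuous _ _ _ A i x; rewrite inE => /(_ ix).
Qed.

(** Around a point of [dom i] the bump is a cube bump composed with a transition map. Any other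
    point avoids the image of the cube, which is compact and so closed in the Hausdorff space M; the
    bump is zero on a whole neighbourhood of it. *)
Lemma C1M_chart_bump i a r : hausdorff_space M -> 0 < r -> cube a r `<=` cod i ->
  C1M (chart_bump i a r).
Proof.
move=> hM r0 ac j; apply: C1on_local => y jy.
have [iq|niq] := pselect (dom i (psi j y)).
  exists (phi j @` (dom j `&` dom i)); split.
    by have [? ?] := psiK jy; exists (psi j y).
  apply: (eq_C1on (@open_transition_dom j i)
    (f := cube_bump a r \o (phi i \o psi j))).
    by move=> _ [q [jq iq'] <-]; rewrite /= phi_psi// chart_bump_in.
  apply: (@C1on_comp _ _ _ _ _ setT) (C1on_cube_bump a r) => //;
    first exact: open_transition_dom.
  by move=> l; exact: C1on_transition.
have cK := compact_closed hM (compact_psi_cube ac).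
exists (cod j `&` psi j @^-1` (~` (psi i @` cube a r))); split.
  split=> // -[x /ac ix xy]; apply: niq; rewrite -xy.
  by have [] := psiK ix.
apply: (eq_C1on _ _ (C1on_cst 0)).
  by apply: open_psi_preimage; exact: closed_openC.
by move=> z [jz zK]; rewrite /= chart_bump_supp.
Qed.

End geometry.

(** * Cover by bumps, finite volume, integration of continuous functions *)

Section integration.
Context {R : realType} {n : nat} {M : ptopologicalType}.
Context {A : smooth_atlas R n M} (g : riemannian_metric A).
Hypothesis M_closed : closed_manifold M.
Context (dV : {measure set (borel M) -> \bar R}).
Hypothesis dVE : riemannian_volume g dV.
Implicit Types (i j : chart A) (p q : M) (x : 'rV[R]_n) (u v : M -> R).

Local Notation chart_at := (@chart_at R n M A).
Local Notation chart_atP := (@chart_atP R n M A).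

Lemma cube_nbhs (a : 'rV[R]_n) (Q : set 'rV[R]_n) : nbhs a Q ->
  exists2 r, 0 < r & cube a r `<=` Q.
Proof.
move=> /nbhs_ballP[e /= e0 eQ]; exists (e / 2); first by rewrite divr_gt0.
move=> x xc; apply: eQ; split=> // i k; rewrite ord1 /ball/= distrC.
apply: (@le_lt_trans _ _ (e / 2)); last by rewrite ltr_pdivrMr// ltr_pMr// ltr1n.
by rewrite ler_distl.
Qed.

Lemma ex_radius p : exists r, 0 < r /\ cube (phi (chart_at p) p) r `<=` cod
  (chart_at p).
Proof.
have [|r r0 rc] := @cube_nbhs (phi (chart_at p) p) (cod (chart_at p)).
  by apply: open_nbhs_nbhs; split; [exact: open_cod|exact: cod_phi (chart_atP p)].
by exists r.
Qed.

Definition radius p : R := sval (cid (ex_radius p)).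

Lemma radius_gt0 p : 0 < radius p.
Proof. by have [] := svalP (cid (ex_radius p)). Qed.

Lemma radius_cod p : cube (phi (chart_at p) p) (radius p) `<=` cod (chart_at p).
Proof. by have [] := svalP (cid (ex_radius p)). Qed.

(* A compactly supported bump that is positive at p; finitely many of them cover
   M, and normalizing their sum gives a partition of unity. *)
Definition pbump p : M -> R := chart_bump (chart_at p) (phi (chart_at p) p)
  (radius p).

Lemma C1M_pbump p : C1M (A := A) (pbump p).
Proof. by apply: C1M_chart_bump; [case: M_closed|exact: radius_gt0|exact:
  radius_cod]. Qed.

Lemma pbump_gt0 p : 0 < pbump p p.
Proof.
by rewrite /pbump chart_bump_in; [exact: cube_bump_gt0 (radius_gt0 p)|exact:
  chart_atP].
Qed.

Definition pcell p : set M := psi (chart_at p) @` cube (phi (chart_at p) p)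
  (radius p).

Lemma pbump_supp p q : ~ pcell p q -> pbump p q = 0.
Proof. by apply: chart_bump_supp; [exact: radius_gt0|exact: radius_cod]. Qed.

Lemma pbump_cover : exists s : seq M, forall p, exists2 q, q \in s & 0 < pbump q p.
Proof.
have [_ cM] := M_closed; move: cM; rewrite compact_cover => cM.
have [||s _ sM] := cM M setT (fun q => [set p | 0 < pbump q p]).
- move=> q _; have qc := C1M_continuous (C1M_pbump q).
  by apply: (@open_comp _ _ (pbump q) [set t | 0 < t]) => [t _|];
    [exact: qc|exact: open_gt].
- by move=> p _; exists p => //; exact: pbump_gt0.
by exists (finmap.enum_fset s) => p; have [q qs pq] := sM p I; exists q.
Qed.

(** The density is continuous, hence bounded on the compact cube, and the cube has finite Lebesgue
    measure. *)
Lemma dV_cube i a r : cube a r `<=` cod i -> 0 <= r ->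
  (dV (psi i @` cube a r) < +oo)%E.
Proof.
move=> ac r0; pose K := psi i @` cube a r.
have cK : compact K := compact_psi_cube ac.
have mK : measurable (K : set (borel M)).
  by apply: measurable_closed; apply: compact_closed cK; case: M_closed.
have Kdom : K `<=` dom i by move=> _ [x /ac/psiK[? _] <-].
have [B B0 sB] := @compact_bounded_fun R _ (sqrt_det g i) _ (@compact_cube R n a r)
  (fun x xa => C1on_continuous (@C1on_sqrt_det _ _ _ _ g i) (ac x xa)).
have mi : measurable_fun setT (\1_K : borel M -> R) by exact: measurable_indic.
have mc := measurable_cube a r.
have -> : dV (psi i @` cube a r) = (\int[dV]_(p in dom i) (\1_K p)%:E)%E.
  rewrite integral_indic//; last by apply: measurable_open; exact: open_dom.
  by congr (dV _); apply/esym/setIidl.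
rewrite (ge0_integral_chart dVE)//.
apply: (@le_lt_trans _ _ (\int[nint_measure n]_(x in cod i)
  (B%:E * (\1_(cube a r) x)%:E))%E).
  apply: ge0_le_integral => //.
  - exact: measurable_cod.
  - by move=> x _; rewrite lee_fin mulr_ge0// sqrt_det_ge0.
  - exact: measurable_density.
  - by apply: measurable_funeM; apply/measurable_EFinP; exact: measurable_funTS.
  - move=> x ix; rewrite -EFinM lee_fin !indicE.
    have [xc|xc] := pselect (cube a r x).
      by rewrite [x \in cube _ _]mem_set// mem_set ?mulr1;
        [exact: le_trans (ler_norm _) (sB x xc)|exists x].
    rewrite [psi i x \in K](_ : _ = false) ?mulr0 ?mulr_ge0//.
    apply/negP; rewrite inE => -[y yc yx]; apply: xc.
    by have [_ <-] := psiK ix; rewrite -yx; have [_ ->] := psiK (ac _ yc).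
rewrite ge0_integralZl_EFin//; last 2 first.
- exact: measurable_cod.
- by apply/measurable_EFinP; exact: measurable_funTS.
rewrite integral_indic//; last exact: measurable_cod.
have nE : (nint_measure n (cube a r) < +oo)%E by rewrite nint_measure_cube// ltry.
by rewrite (setIidl ac); exact: lte_mul_pinfty nE.
Qed.

(** [riemannian_volume] evaluates dV only on sets inside one chart. By compactness finitely many
    cells, each inside a chart, cover M. *)
Lemma dV_finite : (dV setT < +oo)%E.
Proof.
have [s sM] := pbump_cover.
have [B [mB Boo sB]] : exists B : set (borel M), [/\ measurable B, (dV B < +oo)%E &
    forall q, q \in s -> pcell q `<=` B].
  elim: s {sM} => [|q s [B [mB Boo sB]]].
    by exists set0; split => //; rewrite measure0.
  have mq : measurable (pcell q : set (borel M)).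
    apply: measurable_closed; apply: compact_closed; first by case: M_closed.
    by apply: compact_psi_cube; exact: radius_cod.
  exists (pcell q `|` B); split; first exact: measurableU.
    apply: (le_lt_trans (measureU2 _ mq mB)); rewrite lte_add_pinfty//.
    by apply: dV_cube; [exact: radius_cod|exact: ltW (radius_gt0 q)].
  by move=> t; rewrite in_cons => /orP[/eqP->|/sB tB] p tp; [left|right; exact: tB].
apply: le_lt_trans Boo; apply: le_measure; rewrite ?inE//.
move=> p _; have [q qs pq] := sM p; apply: (sB q qs).
by apply: contrapT => /pbump_supp pq0; move: pq; rewrite pq0 ltxx.
Qed.

Lemma continuous_integrable u : continuous u ->
  dV.-integrable setT (EFin \o (u : borel M -> R)).
Proof.
move=> uc.
have mu : measurable_fun setT (u : borel M -> R).
  by apply: continuous_borel_measurable; [exact: openT|move=> p _; exact: uc].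
have [_ cM] := M_closed.
have [B B0 uB] := compact_bounded_fun cM (fun p _ => uc p).
apply: (measurable_bounded_integrable measurableT dV_finite mu).
exists B; split; first exact: ger0_real.
by move=> x /ltW Bx y /uB /le_trans; apply.
Qed.

(** Positive and negative parts of u are again continuous and zero off [dom i], and multiplication
    by the nonnegative density commutes with taking them. *)
Lemma integral_chart i u : continuous u -> (forall p, ~ dom i p -> u p = 0) ->
  (\int[dV]_p (u p)%:E =
   \int[nint_measure n]_(x in cod i) (sqrt_det g i x * u (psi i x))%:E)%E.
Proof.
move=> uc u0.
have pos (h : M -> R) : continuous h -> (forall p, ~ dom i p -> h p = 0) ->
    (forall p, 0 <= h p) -> (\int[dV]_p (h p)%:E =
   \int[nint_measure n]_(x in cod i) (sqrt_det g i x * h (psi i x))%:E)%E.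
  move=> hc h0 hpos; rewrite -(ge0_integral_chart dVE)//; last first.
    by apply: continuous_borel_measurable; [exact: openT|move=> p _; exact: hc].
  rewrite [RHS]integral_mkcond; apply: eq_integral => p _; rewrite patchE.
  by case: ifPn => // /negP ip; rewrite h0// => /mem_set.
rewrite integralE [RHS]integralE.
have maxc (f : M -> R) : continuous f -> continuous (fun p => Num.max (f p) 0).
  by move=> fc p; apply: continuous_max; [exact: fc|exact: cst_continuous].
have := pos (fun p => Num.max (u p) 0) (maxc _ uc).
have := pos (fun p => Num.max (- u p) 0) (maxc _ (fun p => continuousN (uc p))).
move=> En Ep; congr (_ - _)%E.
  transitivity (\int[dV]_p (Num.max (u p) 0)%:E)%E.
    by apply: eq_integral => p _; rewrite funeposE EFin_max.
  rewrite Ep; [|by move=> p /u0 ->; rewrite maxxx|by move=> p; rewrite le_max lexx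
    orbT].
  apply: eq_integral => x _; rewrite funeposE -EFin_max; congr EFin.
  by rewrite maxr_pMr ?sqrt_det_ge0// mulr0.
transitivity (\int[dV]_p (Num.max (- u p) 0)%:E)%E.
  by apply: eq_integral => p _; rewrite funenegE EFin_max.
rewrite En; [|by move=> p /u0 ->; rewrite oppr0 maxxx|by move=> p;
  rewrite le_max lexx orbT].
apply: eq_integral => x _; rewrite funenegE -EFinN -EFin_max; congr EFin.
by rewrite maxr_pMr ?sqrt_det_ge0// mulr0 mulrN.
Qed.

End integration.

(** * Green's identity *)

Section green_identity.
Context {R : realType} {n : nat} {M : ptopologicalType}.
Context {A : smooth_atlas R n M} (g : riemannian_metric A).
Hypothesis M_closed : closed_manifold M.
Context (dV : {measure set (borel M) -> \bar R}).
Hypothesis dVE : riemannian_volume g dV.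
Implicit Types (i j : chart A) (p q : M) (x : 'rV[R]_n) (u v w : M -> R).

(** [fine] would turn an infinite integral into 0; by [vintE] this never happens for continuous
    u. *)
Definition vint u : R := fine (\int[dV]_p (u p)%:E).

Lemma vintE u : continuous u -> (\int[dV]_p (u p)%:E = (vint u)%:E)%E.
Proof.
move=> uc; rewrite /vint fineK//; apply: integrable_fin_num => //.
exact: (continuous_integrable M_closed dVE uc).
Qed.

Lemma vintD u v : continuous u -> continuous v ->
  vint (fun p => u p + v p) = vint u + vint v.
Proof.
move=> uc vc; have ui := continuous_integrable M_closed dVE uc.
have vi := continuous_integrable M_closed dVE vc.
exact: (RintegralD measurableT ui vi).
Qed.

Lemma vintZ (c : R) u : continuous u -> vint (fun p => c * u p) = c * vint u.
Proof.
move=> uc; have ui := continuous_integrable M_closed dVE uc.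
exact: (RintegralZl c measurableT ui).
Qed.

Lemma eq_vint u v : u =1 v -> vint u = vint v.
Proof. by move=> uv; congr fine; apply: eq_integral => p _; rewrite uv. Qed.

Lemma vintB u v : continuous u -> continuous v ->
  vint (fun p => u p - v p) = vint u - vint v.
Proof.
move=> uc vc; have ui := continuous_integrable M_closed dVE uc.
have vi := continuous_integrable M_closed dVE vc.
exact: (RintegralB measurableT ui vi).
Qed.

Lemma vint_sum (I : Type) (r : seq I) (F : I -> M -> R) :
  (forall k, continuous (F k)) ->
  vint (fun p => \sum_(k <- r) F k p) = \sum_(k <- r) vint (F k).
Proof.
move=> Fc; elim: r => [|k r IHr].
  rewrite big_nil (@eq_vint _ (fun p => 0 * 0)); last by move=> p; rewrite big_nil
    mul0r.
  by rewrite (@vintZ 0 (fun=> 0)) ?mul0r// => p; exact: cst_continuous.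
rewrite big_cons -IHr -vintD//; first by apply: eq_vint => p; rewrite big_cons.
by move=> p; apply: continuous_sumr => l; exact: Fc.
Qed.

(** If u were positive at p, the density times u would exceed half its value at p on a small
    coordinate cube, and such a cube has measure (2r)^n > 0. *)
Lemma vint_ge0_eq0 u : continuous u -> (forall p, 0 <= u p) -> vint u = 0 ->
  forall p, u p = 0.
Proof.
move=> uc u0 ui0 p; apply/eqP; rewrite eq_le u0 andbT leNgt; apply/negP => up.
have [i ip] := dom_cover A p; have ix := cod_phi ip; set x := phi i p in ix.
pose F y := sqrt_det g i y * u (psi i y).
have Fc : {for x, continuous F}.
  apply: (@continuousM R); first exact: C1on_continuous (@C1on_sqrt_det _ _ _ _ g i)
    ix.
  apply: continuous_comp; last exact: uc.
  by have := @psi_continuous _ _ _ A i x; rewrite inE => /(_ ix).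
have Fx : 0 < F x by rewrite /F mulr_gt0 ?(sqrt_det_gt0 g ix)// phi_psi.
have [r r0 rF] : exists2 r, 0 < r & cube x r `<=` [set y | cod i y /\ F x / 2 < F y].
  apply: cube_nbhs; apply: filterI.
    by apply: open_nbhs_nbhs; split; [exact: open_cod|].
  apply: (Fc [set t | F x / 2 < t]); apply: open_nbhs_nbhs; split;
    first exact: open_gt.
  by rewrite /= ltr_pdivrMr// ltr_pMr// ltr1n.
have mc := measurable_cube x r.
have mF : measurable_fun (cod i : set (borel 'rV[R]_n))
  (EFin \o (F : borel 'rV[R]_n -> R)).
  apply: (@measurable_density _ _ _ _ g i u).
  by apply: continuous_borel_measurable; [exact: openT|move=> q _; exact: uc].
have F0 y : 0 <= F y by rewrite mulr_ge0 ?sqrt_det_ge0.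
have : ((F x / 2)%:E * nint_measure n (cube x r) <= \int[dV]_p (u p)%:E)%E.
  apply: (@le_trans _ _ (\int[dV]_(p in dom i) (u p)%:E)%E); last first.
    apply: ge0_subset_integral => //; first exact: measurable_dom.
      apply/measurable_EFinP.
      by apply: continuous_borel_measurable; [exact: openT|move=> q _; exact: uc].
    by move=> q _; rewrite lee_fin.
  rewrite (ge0_integral_chart dVE)//; last first.
    by apply: continuous_borel_measurable; [exact: openT|move=> q _; exact: uc].
  apply: (@le_trans _ _ (\int[nint_measure n]_(y in cube x r) (F y)%:E)%E);
    last first.
    apply: ge0_subset_integral => //; first exact: measurable_cod.
      by move=> y _; rewrite lee_fin.
    by move=> y /rF[].
  rewrite -integral_cst//; apply: ge0_le_integral => //.
  - by move=> y _; rewrite lee_fin divr_ge0.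
  - apply: (measurable_funS _ _ mF); first exact: measurable_cod.
    by move=> y /rF[].
  - by move=> y /rF[_ /ltW]; rewrite lee_fin.
rewrite vintE// ui0.
have -> : nint_measure n (cube x r) = ((r *+ 2) ^+ n)%:E by apply:
  nint_measure_cube; exact: ltW.
rewrite -EFinM lee_fin leNgt mulr_gt0// ?divr_gt0// exprn_gt0// mulr2n addr_gt0//.
Qed.

Lemma near0_dot_grad u v p : (\forall q \near p, u q = 0) -> dot_grad g u v p = 0.
Proof.
move=> u0; have ip := chart_atP (A := A) p; set i := chart_at p in ip.
have ix := cod_phi ip.
rewrite /dot_grad inner_grad_dchart// -/i (_ : dchart i u (phi i p) = 0) ?mul0mx
  ?mxE//.
apply/rowP => k; rewrite !mxE -(partial_cst 0 k (phi i p)); apply: near_eq_partial.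
have := @psi_continuous _ _ _ A i (phi i p); rewrite inE => /(_ ix) pc.
have : nbhs (psi i (phi i p)) [set q | u q = 0] by rewrite phi_psi.
by move=> /pc.
Qed.

(** The flux already contains first derivatives of v, so here v has to be smooth, while the test
    function of Green's identity is only C^1. *)
Lemma C1on_flux i v k : smooth (A := A) v ->
  C1on (cod i) (fun x => sqrt_det g i x * grad g i v x 0 k).
Proof.
move=> vs; have oc := @open_cod _ _ _ A i.
apply: C1onM => //; first exact: C1on_sqrt_det.
apply: (eq_C1on oc (f := fun x => \sum_l invmx (gram g i x) k l * partial l
  (v \o psi i) x)).
  by move=> x _; rewrite mxE.
apply: C1on_sum => // l; apply: C1onM => //.
  apply: C1on_invmx => // [a b|x]; last exact: gram_unit.
  by apply: smooth_C1on => //; exact: gram_smooth.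
by apply: smooth_C1on => //; apply: smooth_partial; exact: vs.
Qed.

(* In the chart both terms add up to the divergence of u sqrt(det g) grad v,
   which extends by zero to a C^1 field with compact support. *)
Lemma green_identity_local i a r u v (lapv : M -> R) : 0 < r -> cube a r `<=` cod i ->
  C1M (A := A) u -> (forall p, ~ (psi i @` cube a r) p -> u p = 0) ->
  smooth (A := A) v -> continuous lapv ->
  (forall p, dom i p -> laplace g i v p = lapv p) ->
  vint (fun p => u p * lapv p + dot_grad g u v p) = 0.
Proof.
move=> r0 ac uC u0 vs lc lE; have oc := @open_cod _ _ _ A i.
have vC := smooth_C1M vs.
have cK : closed (psi i @` cube a r).
  by apply: compact_closed (compact_psi_cube ac); case: M_closed.
have unear p : ~ (psi i @` cube a r) p -> \forall q \near p, u q = 0.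
  by move=> pK; apply: filterS (open_nbhs_nbhs (conj (closed_openC cK) pK)) => q /u0.
pose F p := u p * lapv p + dot_grad g u v p.
have Fc : continuous F.
  move=> p; apply: (@continuousD R R M (fun p => u p * lapv p) (dot_grad g u v)).
    by apply: (@continuousM R); [exact: (C1M_continuous uC)|exact: lc].
  exact: dot_grad_continuous.
have F0 p : ~ dom i p -> F p = 0.
  move=> ip; have pK : ~ (psi i @` cube a r) p.
    by move=> [x /ac/psiK[? _] xp]; apply: ip; rewrite -xp.
  by rewrite /F u0// mul0r add0r near0_dot_grad//; exact: unear.
rewrite -[LHS]/(fine (\int[dV]_p (F p)%:E)) (integral_chart dVE Fc F0).
pose X k x := sqrt_det g i x * grad g i v x 0 k.
pose W k : 'rV[R]_n -> R := (fun x => u (psi i x) * X k x) \_ (cod i).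
have WE k x : cod i x -> W k x = u (psi i x) * X k x.
  by move=> ix; rewrite /W patchE mem_set.
have W0 k x : ~ cube a r x -> W k x = 0.
  move=> xa; rewrite /W patchE; case: ifPn => // /set_mem ix.
  rewrite u0 ?mul0r// => -[y ya yx]; apply: xa.
  by have [_ <-] := psiK ix; rewrite -yx; have [_ ->] := psiK (ac _ ya).
have WC k : C1on setT (W k).
  apply: C1on_local => x _; have [xa|xa] := pselect (cube a r x).
    exists (cod i); split; first exact: ac.
    apply: (eq_C1on oc (f := fun x => (u \o psi i) x * X k x)).
      by move=> y iy; rewrite WE.
    by apply: (C1onM oc (uC i)); exact: C1on_flux.
  exists (~` cube a r); split => //.
  apply: (eq_C1on _ _ (C1on_cst 0)); first exact: closed_openC (@closed_cube _ _ a r).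
  by move=> y ya; rewrite W0.
(* [integral_partial_eq0] is stated for cubes centered at 0; with this radius such a cube contains
   [cube a r]. *)
pose r' := `|a| + r.
have r'0 : 0 < r' by rewrite ltr_wpDl.
have W0' k x : ~ cube 0 r' x -> W k x = 0.
  move=> xr; apply: W0 => xa; apply: xr => l; rewrite mxE sub0r add0r -ler_norml.
  rewrite -[x 0 l](subrK (a 0 l)) (le_trans (ler_normD _ _))// addrC lerD
    ?coord_le_norm//.
  by rewrite ler_distl.
have pW0 k x : ~ cube a r x -> partial k (W k) x = 0.
  move=> xa; rewrite -(partial_cst 0 k x); apply: near_eq_partial.
  by apply: filterS (open_nbhs_nbhs (conj (closed_openC (@closed_cube _ _ a r)) xa))
    => y /W0.
rewrite [X in fine X](_ : _ = \int[nint_measure n]_x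
  (\sum_k (partial k (W k) x)%:E))%E.
  rewrite integral_sum//.
    by rewrite big1// => k _; exact: (integral_partial_eq0 k (WC k) r'0 (W0' k)).
  move=> k; apply: (@integrable_compact_support _ _ _ r') => //.
  - by move=> x; have [_ wc] := WC k x I; exact: wc.
  - exact: ltW.
  - move=> x xr; rewrite -(partial_cst 0 k x); apply: near_eq_partial.
    by apply: filterS (open_nbhs_nbhs (conj (closed_openC (@closed_cube _ _ 0 r'))
      xr)) => y /W0'.
rewrite integral_mkcond; apply: eq_integral => x _; rewrite patchE.
case: ifPn => [/set_mem ix|/negP ix]; last first.
  rewrite big1// => k _; rewrite pW0// => /ac xi; apply: ix; exact: mem_set.
have [ip xE] := psiK ix.
rewrite sumEFin; congr EFin.
rewrite /F (dot_gradE g uC vC ip) inner_grad_sum// -(lE _ ip) /laplace /dvg xE.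
(* The density cancels its inverse in [dvg]; what remains is the product rule for u times the
   flux. *)
rewrite mulrDr mulrCA mulVKf ?gt_eqF ?sqrt_det_gt0// !mulr_sumr -big_split/=.
apply: eq_bigr => k _.
have -> : partial k (W k) x = partial k (fun y => (u \o psi i) y * X k y) x.
  apply: near_eq_partial.
  by apply: filterS (open_nbhs_nbhs (conj oc ix)) => y /WE.
rewrite [RHS](partialM k (proj1 (uC i x ix)) (proj1 (C1on_flux k vs ix))).
by rewrite /= /X; ring.
Qed.

Lemma dot_grad_sum (I : Type) (s : seq I) (F : I -> M -> R) v p :
  (forall k, C1M (A := A) (F k)) ->
  dot_grad g (fun q => \sum_(k <- s) F k q) v p = \sum_(k <- s) dot_grad g (F k) v p.
Proof.
move=> FC; elim: s => [|k s IHs].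
  rewrite big_nil (_ : (fun q => _) = (fun=> 0)) ?dot_grad_cstl//.
  by apply/funext => q; rewrite big_nil.
rewrite big_cons -IHs -(dot_gradDl g v p (FC k) (C1M_sum s FC)).
by congr (dot_grad g _ v p); apply/funext => q; rewrite big_cons.
Qed.

Lemma green_identity u v (lapv : M -> R) : C1M (A := A) u -> smooth (A := A) v ->
  continuous lapv ->
  (forall i p, dom i p -> laplace g i v p = lapv p) ->
  vint (fun p => u p * lapv p) = - vint (dot_grad g u v).
Proof.
move=> uC vs lc lE; have vC := smooth_C1M vs.
have uc := C1M_continuous uC.
have ulc : continuous (fun p => u p * lapv p).
  by move=> p; apply: (@continuousM R); [exact: uc|exact: lc].
apply/eqP; rewrite -addr_eq0 -vintD//; last exact: dot_grad_continuous.
have [s sM] := pbump_cover M_closed (A := A).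
pose b : M -> M -> R := @pbump R n M A; pose S p := \sum_(q <- s) b q p.
have bC q : C1M (A := A) (b q) by exact: C1M_pbump.
have S0 p : S p != 0.
  have [q qs pq] := sM p; rewrite gt_eqF// /S (big_rem q)//= ltr_pwDl//.
  by apply: sumr_ge0 => q' _; exact: chart_bump_ge0.
have SC : C1M (A := A) S := C1M_sum s bC.
(* The normalization is absorbed into u: it becomes the sum of the pieces [w * b q], each supported
   in a single cell. *)
pose w p := u p * (S p)^-1.
have wC : C1M (A := A) w := C1MM uC (C1MV SC S0).
have uE : u = (fun p => \sum_(q <- s) w p * b q p).
  by apply/funext => p; rewrite -mulr_sumr -/(S p) /w mulfVK.
have wbC q : C1M (A := A) (fun p => w p * b q p) := C1MM wC (bC q).
rewrite (@eq_vint _ (fun p => \sum_(q <- s) ((w p * b q p) * lapv p +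
  dot_grad g (fun p' => w p' * b q p') v p))).
  rewrite vint_sum; last first.
    move=> q p.
    apply: (@continuousD R R M (fun p => w p * b q p * lapv p)
      (dot_grad g (fun p => w p * b q p) v)).
      by apply: (@continuousM R); [exact: (C1M_continuous (wbC q))|exact: lc].
    exact: (dot_grad_continuous (g := g) (wbC q) vC).
  apply/eqP; apply: big1 => q _.
  apply: (green_identity_local (radius_gt0 (A := A) q) (@radius_cod _ _ _ A q)
    (wbC q) _ vs lc (lE _)).
  by move=> p /pbump_supp pq; rewrite /b pq mulr0.
move=> p; rewrite [RHS](big_split _ _ _ (fun q => w p * b q p * lapv p)) /=.
by rewrite -mulr_suml -(dot_grad_sum _ _ _ wbC) -uE -mulr_sumr -/(S p) mulfVK.
Qed.

(** Near p the differential vanishes on a whole coordinate cube. A cube is convex, so the mean value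
    theorem applies along the segment from the coordinates of p to those of q. *)
Lemma dot_grad0_locally_constant u p : C1M (A := A) u ->
  (\forall q \near p, dot_grad g u u q = 0) -> \forall q \near p, u q = u p.
Proof.
move=> uC u0; have [i ip] := dom_cover A p; have ix := cod_phi ip.
have d0 x k : cod i x -> dot_grad g u u (psi i x) = 0 -> partial k (u \o psi i) x = 0.
  move=> jx; have [jq xE] := psiK jx.
  rewrite (dot_gradE g uC uC jq) /inner_grad => G0.
  have [/eqP|g0] := eqVneq (grad g i u (phi i (psi i x))) 0; last first.
    by have := gram_pos g (cod_phi jq) g0; rewrite G0 ltxx.
  rewrite gradE ?xE// => /eqP/(congr1 (mulmx^~ (gram g i x))).
  by rewrite mulmxKV ?gram_unit// mul0mx => /rowP/(_ k); rewrite !mxE.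
have nx : nbhs (phi i p) [set x | cod i x /\ dot_grad g u u (psi i x) = 0].
  apply: filterI; first exact: (open_nbhs_nbhs (conj (@open_cod _ _ _ A i) ix)).
  have := @psi_continuous _ _ _ A i (phi i p); rewrite inE => /(_ ix) pc.
  have : nbhs (psi i (phi i p)) [set q | dot_grad g u u q = 0] by rewrite phi_psi.
  by move=> /pc.
have [r r0 rc] := cube_nbhs nx.
have : \forall q \near p, dom i q /\ cube (phi i p) r (phi i q).
  apply: near_chart => //; apply/nbhs_ballP; exists r => //= y [_ yr] k.
  by rewrite -ler_distl distrC ltW//; exact: yr.
apply: filterS => q [iq qr].
pose y := phi i q - phi i p.
have yc t : 0 <= t <= 1 ->
    cod i (phi i p + t *: y) /\ dot_grad g u u (psi i (phi i p + t *: y)) = 0.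
  move=> /andP[t0 t1]; apply: rc => k; rewrite -ler_distl !mxE addrAC subrr add0r.
  rewrite normrM (ger0_norm t0).
  have : `|phi i q 0 k - phi i p 0 k| <= r by rewrite ler_distl; exact: qr.
  by apply: le_trans; rewrite ler_piMl.
have [|t t01] := @mean_value_line R n (u \o psi i) (phi i p) y.
  by move=> t /yc[/(uC i)[? _] _]; exact: diff_derivable.
have -> : phi i p + y = phi i q by rewrite /y addrC subrK.
rewrite /= !phi_psi// => /eqP; rewrite subr_eq => /eqP ->.
have [ct gt] := yc _ t01; have [ud _] := uC i _ ct.
rewrite deriveE// [X in 'd _ _ X]row_sum_delta linear_sum/= big1 ?add0r// => k _.
by rewrite linearZ_LR/= -deriveE// -/(partial k _ _) d0 ?scaler0.
Qed.

End green_identity.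

(** * Moments of an eigenfunction *)

Section complex_integral.
Context {R : realType} {n : nat} {M : ptopologicalType}.
Context {A : smooth_atlas R n M} (g : riemannian_metric A).
Hypothesis M_closed : closed_manifold M.
Context (dV : {measure set (borel M) -> \bar R}).
Hypothesis dVE : riemannian_volume g dV.
Local Notation C := (complex R).
Implicit Types F G : M -> C.

Definition contC F := continuous (fun p => complex.Re (F p)) /\
  continuous (fun p => complex.Im (F p)).

Definition C1C F := C1M (A := A) (fun p => complex.Re (F p)) /\
  C1M (A := A) (fun p => complex.Im (F p)).

Definition vintC F : C := (vint dV (fun p => complex.Re (F p)) +i*
  vint dV (fun p => complex.Im (F p)))%C.

Lemma C1C_cont F : C1C F -> contC F.
Proof. by move=> [/C1M_continuous ? /C1M_continuous ?]. Qed.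

Lemma Re_mulc (a b : C) : complex.Re (a * b) =
  complex.Re a * complex.Re b - complex.Im a * complex.Im b.
Proof. by case: a; case: b. Qed.

Lemma Im_mulc (a b : C) : complex.Im (a * b) =
  complex.Re a * complex.Im b + complex.Im a * complex.Re b.
Proof. by case: a; case: b. Qed.

Lemma Re_addc (a b : C) : complex.Re (a + b) = complex.Re a + complex.Re b.
Proof. by case: a; case: b. Qed.

Lemma Im_addc (a b : C) : complex.Im (a + b) = complex.Im a + complex.Im b.
Proof. by case: a; case: b. Qed.

Lemma complex_ext (a b : C) : complex.Re a = complex.Re b ->
  complex.Im a = complex.Im b -> a = b.
Proof. by case: a; case: b => /= ? ? ? ? -> ->. Qed.

Lemma C1C_cst (c : C) : C1C (fun=> c).
Proof. by split; exact: C1M_cst. Qed.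

Lemma C1CM F G : C1C F -> C1C G -> C1C (fun p => F p * G p).
Proof.
move=> [F1 F2] [G1 G2]; split.
  rewrite (_ : (fun p => _) = (fun p => complex.Re (F p) * complex.Re (G p) +
    - (complex.Im (F p) * complex.Im (G p)))).
    exact: (C1MD (C1MM F1 G1) (C1MN (C1MM F2 G2))).
  by apply/funext => p; rewrite Re_mulc.
rewrite (_ : (fun p => _) = (fun p => complex.Re (F p) * complex.Im (G p) +
    complex.Im (F p) * complex.Re (G p))).
  exact: (C1MD (C1MM F1 G2) (C1MM F2 G1)).
by apply/funext => p; rewrite Im_mulc.
Qed.

Lemma C1CD F G : C1C F -> C1C G -> C1C (fun p => F p + G p).
Proof.
move=> [F1 F2] [G1 G2]; split.
  rewrite (_ : (fun p => _) = (fun p => complex.Re (F p) + complex.Re (G p))).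
    exact: (C1MD F1 G1).
  by apply/funext => p; rewrite Re_addc.
rewrite (_ : (fun p => _) = (fun p => complex.Im (F p) + complex.Im (G p))).
  exact: (C1MD F2 G2).
by apply/funext => p; rewrite Im_addc.
Qed.

Lemma C1CN F : C1C F -> C1C (fun p => - F p).
Proof.
move=> [F1 F2]; split.
  rewrite (_ : (fun p => _) = (fun p => - complex.Re (F p))); first exact: (C1MN F1).
  by apply/funext => p; case: (F p).
rewrite (_ : (fun p => _) = (fun p => - complex.Im (F p))); first exact: (C1MN F2).
by apply/funext => p; case: (F p).
Qed.

Lemma C1CX F k : C1C F -> C1C (fun p => F p ^+ k).
Proof.
move=> FC; elim: k => [|k IHk]; first exact: (C1C_cst 1).
rewrite (_ : (fun p => _) = (fun p => F p * F p ^+ k)); first exact: (C1CM FC IHk).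
by apply/funext => p; rewrite exprS.
Qed.

Lemma contCM F G : contC F -> contC G -> contC (fun p => F p * G p).
Proof.
move=> [F1 F2] [G1 G2]; split.
  rewrite (_ : (fun p => _) = (fun p => complex.Re (F p) * complex.Re (G p) -
    complex.Im (F p) * complex.Im (G p))).
    move=> p; apply: (@continuousB R R M (fun p => complex.Re (F p) * complex.Re
      (G p))
      (fun p => complex.Im (F p) * complex.Im (G p))); apply: (@continuousM R);
      by [exact: F1|exact: F2|exact: G1|exact: G2].
  by apply/funext => p; rewrite Re_mulc.
rewrite (_ : (fun p => _) = (fun p => complex.Re (F p) * complex.Im (G p) +
    complex.Im (F p) * complex.Re (G p))).
  move=> p; apply: (@continuousD R R M (fun p => complex.Re (F p) * complex.Im (G p))
      (fun p => complex.Im (F p) * complex.Re (G p))); apply: (@continuousM R);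
      by [exact: F1|exact: F2|exact: G1|exact: G2].
by apply/funext => p; rewrite Im_mulc.
Qed.

Lemma contCD F G : contC F -> contC G -> contC (fun p => F p + G p).
Proof.
move=> [F1 F2] [G1 G2]; split.
  rewrite (_ : (fun p => _) = (fun p => complex.Re (F p) + complex.Re (G p))).
    by move=> p; apply: (@continuousD R R M); [exact: F1|exact: G1].
  by apply/funext => p; rewrite Re_addc.
rewrite (_ : (fun p => _) = (fun p => complex.Im (F p) + complex.Im (G p))).
  by move=> p; apply: (@continuousD R R M); [exact: F2|exact: G2].
by apply/funext => p; rewrite Im_addc.
Qed.

Lemma vintCD F G : contC F -> contC G ->
  vintC (fun p => F p + G p) = vintC F + vintC G.
Proof.
move=> [F1 F2] [G1 G2]; rewrite /vintC.
apply: complex_ext; rewrite /= -(vintD M_closed dVE)//.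
  by apply: eq_vint => p; rewrite Re_addc.
by apply: eq_vint => p; rewrite Im_addc.
Qed.

Lemma vintCZ (c : C) F : contC F -> vintC (fun p => c * F p) = c * vintC F.
Proof.
move=> [F1 F2]; rewrite /vintC.
have cZ (r : R) (u : M -> R) : continuous u -> continuous (fun p => r * u p).
  by move=> uc p; apply: (@continuousM R); [exact: cst_continuous|exact: uc].
apply: complex_ext.
  rewrite Re_mulc /= -mulNr -!(vintZ M_closed dVE)// -(vintD M_closed dVE);
    try exact: cZ.
  by apply: eq_vint => p; rewrite Re_mulc mulNr.
rewrite Im_mulc /= -!(vintZ M_closed dVE)// -(vintD M_closed dVE); try exact: cZ.
by apply: eq_vint => p; rewrite Im_mulc.
Qed.

Lemma eq_vintC F G : F =1 G -> vintC F = vintC G.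
Proof. by move=> FG; rewrite /vintC; congr (_ +i* _)%C; apply: eq_vint => p;
  rewrite FG. Qed.

Variables f1 f2 : M -> R.

(* kappa(F, f) for f = f1 + i f2; below, grad_sq is kappa(f, conj f). *)
Definition kappa_f F p : C :=
  ((dot_grad g (fun q => complex.Re (F q)) f1 p -
    dot_grad g (fun q => complex.Im (F q)) f2 p) +i*
   (dot_grad g (fun q => complex.Im (F q)) f1 p +
     dot_grad g (fun q => complex.Re (F q)) f2 p))%C.

Definition grad_sq p : C := ((dot_grad g f1 f1 p + dot_grad g f2 f2 p) +i* 0)%C.

Lemma kappa_fM F G p : C1C F -> C1C G ->
  kappa_f (fun q => F q * G q) p = F p * kappa_f G p + G p * kappa_f F p.
Proof.
move=> [F1 F2] [G1 G2].
have reE v : dot_grad g (fun q => complex.Re (F q * G q)) v p =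
    (complex.Re (F p) * dot_grad g (fun q => complex.Re (G q)) v p +
     complex.Re (G p) * dot_grad g (fun q => complex.Re (F q)) v p) -
    (complex.Im (F p) * dot_grad g (fun q => complex.Im (G q)) v p +
     complex.Im (G p) * dot_grad g (fun q => complex.Im (F q)) v p).
  transitivity (dot_grad g (fun q => complex.Re (F q) * complex.Re (G q) +
      - (complex.Im (F q) * complex.Im (G q))) v p).
    by congr (dot_grad g _ v p); apply/funext => q; rewrite Re_mulc.
  rewrite (dot_gradDl g v p (C1MM F1 G1) (C1MN (C1MM F2 G2)))
    (dot_gradNl g v p (C1MM F2 G2)).
  by rewrite (dot_gradMl g v p F1 G1) (dot_gradMl g v p F2 G2).
have imE v : dot_grad g (fun q => complex.Im (F q * G q)) v p =
    (complex.Re (F p) * dot_grad g (fun q => complex.Im (G q)) v p +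
     complex.Im (G p) * dot_grad g (fun q => complex.Re (F q)) v p) +
    (complex.Im (F p) * dot_grad g (fun q => complex.Re (G q)) v p +
     complex.Re (G p) * dot_grad g (fun q => complex.Im (F q)) v p).
  rewrite -(dot_gradMl g v p F1 G2) -(dot_gradMl g v p F2 G1)
    -(dot_gradDl g v p (C1MM F1 G2) (C1MM F2 G1)).
  by congr (dot_grad g _ v p); apply/funext => q; rewrite Im_mulc.
rewrite /kappa_f (reE f1) (reE f2) (imE f1) (imE f2) {reE imE}.
move: (dot_grad g (fun q => complex.Re (F q)) f1 p)
  (dot_grad g (fun q => complex.Re (F q)) f2 p)
  (dot_grad g (fun q => complex.Im (F q)) f1 p)
    (dot_grad g (fun q => complex.Im (F q)) f2 p)
  (dot_grad g (fun q => complex.Re (G q)) f1 p)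
    (dot_grad g (fun q => complex.Re (G q)) f2 p)
  (dot_grad g (fun q => complex.Im (G q)) f1 p)
    (dot_grad g (fun q => complex.Im (G q)) f2 p).
case: (F p) (G p) => a b [c d] /= *.
by apply: complex_ext => /=; ring.
Qed.

End complex_integral.

(** * Algebra of the rotation field and of rotation invariant moments *)

Section moments.
Variable R : realType.

(* The rotation field x d/dy - y d/dx applied to x^a y^b z^j w^k, where
   z = x + I y and w = x - I y. The junk powers a.-1 and b.-1 at 0 come with the
   coefficient 0. *)
Definition rotation_term (C : comUnitRingType) (I x y z w : C) (a b j k : nat) : C :=
  (b%:R * x ^+ a.+1 * y ^+ b.-1 - a%:R * x ^+ a.-1 * y ^+ b.+1 +
   I * (j%:R - k%:R) * x ^+ a * y ^+ b) * (z ^+ j * w ^+ k).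

Section rotation_term.
Variables (C : fieldType) (I x y z w : C).
Hypotheses (C2 : 2%:R != 0 :> C) (I2 : I * I = -1).
Hypotheses (zE : z = x + I * y) (wE : w = x - I * y).

Let xE : x = 2%:R^-1 * (z + w).
Proof.
have -> : z + w = 2%:R * x by rewrite zE wE; ring.
by rewrite mulKf.
Qed.

Let yE : y = - 2%:R^-1 * I * (z - w).
Proof.
have -> : z - w = 2%:R * (I * y) by rewrite zE wE; ring.
transitivity (- (I * I) * (2%:R^-1 * 2%:R) * y); last by ring.
by rewrite I2 mulVf// opprK !mul1r.
Qed.

(** Both sides are the rotation derivative of the same function, one factor x being written as (z +
    w) / 2. Since the field maps z to I z and w to - I w, trading all x and y for z and w in this
    manner leaves only I (j - k) z^j w^k. *)
Lemma rotation_termSl a b j k : rotation_term I x y z w a.+1 b j k =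
  2%:R^-1 * (rotation_term I x y z w a b j.+1 k + rotation_term I x y z w a b j k.+1).
Proof.
pose B := b%:R * x ^+ a.+1 * y ^+ b.-1 - a%:R * x ^+ a.-1 * y ^+ b.+1 +
   I * (j%:R - k%:R) * x ^+ a * y ^+ b.
pose Z := z ^+ j * w ^+ k.
have -> : 2%:R^-1 * (rotation_term I x y z w a b j.+1 k +
      rotation_term I x y z w a b j k.+1) =
    (B * (2%:R^-1 * (z + w)) - (x ^+ a * y ^+ b) * (- 2%:R^-1 * I * (z - w))) * Z.
  by rewrite /rotation_term /B /Z !exprS -!natr1; ring.
rewrite -xE -yE /rotation_term /B -/Z; congr (_ * _).
case: a {B} => [|a]; rewrite !exprS -?natr1 /=; ring.
Qed.

Lemma rotation_termSr a b j k : rotation_term I x y z w a b.+1 j k =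
  (- 2%:R^-1 * I) * (rotation_term I x y z w a b j.+1 k -
    rotation_term I x y z w a b j k.+1).
Proof.
pose B := b%:R * x ^+ a.+1 * y ^+ b.-1 - a%:R * x ^+ a.-1 * y ^+ b.+1 +
   I * (j%:R - k%:R) * x ^+ a * y ^+ b.
pose Z := z ^+ j * w ^+ k.
have -> : (- 2%:R^-1 * I) * (rotation_term I x y z w a b j.+1 k -
      rotation_term I x y z w a b j k.+1) =
    (B * (- 2%:R^-1 * I * (z - w)) - (I * I) * (x ^+ a * y ^+ b) *
      (2%:R^-1 * (z + w))) * Z.
  by rewrite /rotation_term /B /Z !exprS -!natr1; ring.
rewrite I2 -xE -yE /rotation_term /B -/Z; congr (_ * _).
case: b {B} => [|b]; rewrite !exprS -?natr1 /=; ring.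
Qed.

End rotation_term.

Variable m : nat -> nat -> R.
Hypothesis mE : forall a b, b%:R * m a.+1 b.-1 = a%:R * m a.-1 b.+1.

(** [mE] moves two powers at a time from one variable to the other. An odd exponent thereby comes
    down to 1, where the instance of [mE] with coefficient 0 on one side makes the moment vanish. *)
Lemma moment_odd a b : ~ (~~ odd a /\ ~~ odd b) -> m a b = 0.
Proof.
have S0 k : k.+1%:R != 0 :> R by rewrite pnatr_eq0.
have oddl c d : odd c -> m c d = 0.
  have [l] := ubnP c; elim: l c d => // l IHl [|[|c]] d //= cl oc.
    by apply/eqP; have /eqP := mE 0 d.+1; rewrite mul0r mulf_eq0 (negbTE (S0 d)).
  apply/eqP; have /eqP := mE c.+1 d.+1; rewrite /= (IHl c d.+2); last 2 first.
  - by rewrite ltnW.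
  - by move: oc; rewrite negbK.
  by rewrite mulr0 mulf_eq0 (negbTE (S0 d)).
have oddr c d : odd d -> m c d = 0.
  have [l] := ubnP d; elim: l c d => // l IHl c [|[|d]] //= dl od.
    by apply/eqP; have /esym/eqP := mE c.+1 0; rewrite mul0r mulf_eq0 (negbTE (S0 c)).
  apply/eqP; have /esym/eqP := mE c.+1 d.+1; rewrite /= (IHl c.+2 d); last 2 first.
  - by rewrite ltnW.
  - by move: od; rewrite negbK.
  by rewrite mulr0 mulf_eq0 (negbTE (S0 c)).
move=> ab; have [/oddl->//|na] := boolP (odd a).
by have [/oddr->//|nb] := boolP (odd b); case: ab.
Qed.

(** Induction on b with 2a + 2b fixed: [mE] gives (2a + 1) m(2a, 2b + 2) = (2b + 1) m(2a + 2, 2b),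
    and the quotient of binomials obeys the same recurrence. *)
Lemma moment_even a b : m (2 * a) (2 * b) =
  'C(a + b, a)%:R / 'C(2 * a + 2 * b, 2 * a)%:R * m (2 * a + 2 * b) 0.
Proof.
have S0 k : k.+1%:R != 0 :> R by rewrite pnatr_eq0.
elim: b a => [|b IH] a.
  by rewrite muln0 !addn0 !binn divff ?oner_neq0// mul1r.
have := mE (2 * a).+1 (2 * b).+1; rewrite /=.
have -> : (2 * a).+2 = (2 * a.+1)%N by lia.
have -> : (2 * b).+2 = (2 * b.+1)%N by lia.
rewrite IH.
have -> : (a.+1 + b = a + b.+1)%N by lia.
have -> : (2 * a.+1 + 2 * b = 2 * a + 2 * b.+1)%N by lia.
set N := (a + b.+1)%N; set N2 := (2 * a + 2 * b.+1)%N.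
(* Neighbouring binomials, one step in row N and two in row N2, reduce everything to C(N, a) and
   C(N2, 2a). *)
have h1 : a.+1%:R * 'C(N, a.+1)%:R = b.+1%:R * 'C(N, a)%:R :> R.
  by rewrite -!natrM mul_bin_left; congr (_ * _)%:R; rewrite /N; lia.
have h2 : (2 * a).+1%:R * 'C(N2, (2 * a).+1)%:R = (2 * b).+2%:R * 'C(N2, 2 * a)%:R
  :> R.
  by rewrite -!natrM mul_bin_left; congr (_ * _)%:R; rewrite /N2; lia.
have h3 : (2 * a.+1)%:R * 'C(N2, 2 * a.+1)%:R = (2 * b).+1%:R *
  'C(N2, (2 * a).+1)%:R :> R.
  rewrite -!natrM (_ : 2 * a.+1 = (2 * a).+2)%N; last by lia.
  by rewrite mul_bin_left; congr (_ * _)%:R; rewrite /N2; lia.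
have c1 : 'C(N2, 2 * a)%:R != 0 :> R by rewrite pnatr_eq0 -lt0n bin_gt0 /N2; lia.
have c2 : 'C(N2, (2 * a).+1)%:R != 0 :> R by rewrite pnatr_eq0 -lt0n bin_gt0 /N2; lia.
have c3 : 'C(N2, 2 * a.+1)%:R != 0 :> R by rewrite pnatr_eq0 -lt0n bin_gt0 /N2; lia.
move=> h.
have e1 : 'C(N, a.+1)%:R = b.+1%:R * 'C(N, a)%:R / a.+1%:R :> R.
  by rewrite -h1 mulrAC divff ?mul1r.
have e2 : 'C(N2, (2 * a).+1)%:R = (2 * b).+2%:R * 'C(N2, 2 * a)%:R / (2 * a).+1%:R
  :> R.
  by rewrite -h2 mulrAC divff ?mul1r.
have e3 : 'C(N2, 2 * a.+1)%:R = (2 * b).+1%:R * 'C(N2, (2 * a).+1)%:R /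
  (2 * a).+2%:R :> R.
  by rewrite -h3 (_ : 2 * a.+1 = (2 * a).+2)%N; [rewrite mulrAC divff ?mul1r|lia].
apply: (mulfI (S0 (2 * a))); rewrite -h e3 e2 e1.
rewrite (_ : (2 * a).+2 = 2 * a.+1)%N; last by lia.
rewrite (_ : (2 * b).+2 = 2 * b.+1)%N; last by lia.
rewrite !natrM; field.
have Sa k : 1 + k%:R != 0 :> R by rewrite addrC natr1 S0.
by rewrite c1 -!natrM !Sa.
Qed.

End moments.

Lemma continuous_exprn (R : realType) (T : topologicalType) (u : T -> R) k :
  continuous u -> continuous (fun p => u p ^+ k).
Proof.
move=> uc p; elim: k => [|k IHk]; first exact: cst_continuous.
rewrite (_ : (fun p => _) = (fun p => u p * u p ^+ k));
  last by apply/funext => q; rewrite exprS.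
by apply: (@continuousM R T u (fun p => u p ^+ k)) => //; exact: uc.
Qed.

(** * The mixed moments of f and its conjugate *)

Section eigenfunction_moments.
Context {R : realType} {n : nat} {M : ptopologicalType}.
Context {A : smooth_atlas R n M} (g : riemannian_metric A).
Hypothesis M_closed : closed_manifold M.
Context (dV : {measure set (borel M) -> \bar R}).
Hypothesis dVE : riemannian_volume g dV.
Variables (lambda mu : complex R) (f1 f2 : M -> R).
Hypothesis f_eigen : eigenfunction g lambda mu (fun p => (f1 p +i* f2 p)%C).
Local Notation C := (complex R).
Local Notation z := (fun p => (f1 p +i* f2 p)%C : C).
Local Notation w := (fun p => (f1 p -i* f2 p)%C : C).
Local Notation vintC := (vintC dV).
Local Notation kappa_f := (kappa_f g f1 f2).
Local Notation grad_sq := (grad_sq g f1 f2).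

Let f1s : smooth (A := A) f1. Proof. have [h _ _] := f_eigen; exact: h. Qed.
Let f2s : smooth (A := A) f2. Proof. have [_ h _] := f_eigen; exact: h. Qed.
Let f1C : C1M (A := A) f1 := smooth_C1M f1s.
Let f2C : C1M (A := A) f2 := smooth_C1M f2s.
Let zC : C1C (A := A) z := conj f1C f2C.
Let wC : C1C (A := A) w := conj f1C (C1MN f2C).

Lemma laplace_re i p : dom i p -> laplace g i f1 p = complex.Re (lambda * z p).
Proof. by move=> ip; have [_ _ /(_ i p ip)[+ _]] := f_eigen =>
  /(congr1 (@complex.Re R)). Qed.

Lemma laplace_im i p : dom i p -> laplace g i f2 p = complex.Im (lambda * z p).
Proof. by move=> ip; have [_ _ /(_ i p ip)[+ _]] := f_eigen =>
  /(congr1 (@complex.Im R)). Qed.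

Lemma kappa_f_z p : kappa_f z p = mu * z p ^+ 2.
Proof.
have [_ _ /(_ _ p (chart_atP (A := A) p))[_ <-]] := f_eigen.
apply: complex_ext; [reflexivity|exact: addrC].
Qed.

Lemma kappa_f_w p : kappa_f w p = grad_sq p.
Proof.
rewrite /kappa_f /grad_sq /= (dot_gradNl g f1 p f2C) (dot_gradNl g f2 p f2C).
by rewrite opprK (dot_gradC g f2 f1) addNr.
Qed.

Lemma kappa_fX F k p : C1C (A := A) F ->
  kappa_f (fun q => F q ^+ k) p = k%:R * F p ^+ k.-1 * kappa_f F p.
Proof.
move=> FC; elim: k => [|k IHk].
  rewrite !mul0r (_ : (fun q => _) = (fun=> 1));
  last by apply/funext => q; rewrite expr0.
  by rewrite /kappa_f /= !dot_grad_cstl subrr addr0.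
rewrite (_ : (fun q => _) = (fun q => F q * F q ^+ k));
  last by apply/funext => q; rewrite exprS.
rewrite (kappa_fM g f1 f2 p FC (C1CX k FC)) IHk /=.
by case: k {IHk} => [|k] /=; rewrite ?exprS -?natr1; ring.
Qed.

(** Four real Green identities, pairing Re F and Im F with f1 and f2, assembled by the
    complex-bilinear product. The Laplacians of f1 and f2 are the real and imaginary parts of lambda
    f, so a complex lambda mixes the two. *)
Lemma green_identityC F : C1C (A := A) F ->
  lambda * vintC (fun p => F p * z p) = - vintC (kappa_f F).
Proof.
move=> FC; have [F1 F2] := FC.
have c1 := C1M_continuous f1C; have c2 := C1M_continuous f2C.
have lzC : C1C (A := A) (fun p => lambda * z p) := C1CM (C1C_cst lambda) zC.
have [lz1 lz2] := C1C_cont lzC.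
have cM (u v : M -> R) : continuous u -> continuous v ->
  continuous (fun p => u p * v p).
  by move=> uc vc p; apply: (@continuousM R); [exact: uc|exact: vc].
have := green_identity M_closed dVE F1 f1s lz1 laplace_re.
have := green_identity M_closed dVE F2 f2s lz2 laplace_im.
have := green_identity M_closed dVE F2 f1s lz1 laplace_re.
have := green_identity M_closed dVE F1 f2s lz2 laplace_im.
move=> E12 E21 E22 E11.
rewrite -(vintCZ M_closed dVE lambda (contCM (C1C_cont FC) (C1C_cont zC))).
rewrite (@eq_vintC _ _ _ _ (fun p => F p * (lambda * z p))); last by move=> p;
  rewrite mulrCA.
have k1 := C1M_continuous F1; have k2 := C1M_continuous F2.
apply: complex_ext.
  transitivity (vint dV (fun p => complex.Re (F p) * complex.Re (lambda * z p) -
      complex.Im (F p) * complex.Im (lambda * z p))).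
  by apply: eq_vint => p; exact: Re_mulc.
  rewrite (vintB M_closed dVE (cM _ _ k1 lz1) (cM _ _ k2 lz2)) E11 E22.
  transitivity (- vint dV (fun p => dot_grad g (fun q => complex.Re (F q)) f1 p -
      dot_grad g (fun q => complex.Im (F q)) f2 p)); last by [].
  rewrite (vintB M_closed dVE (dot_grad_continuous (g := g) F1 f1C)
    (dot_grad_continuous (g := g) F2 f2C)).
  by rewrite opprB opprK addrC.
transitivity (vint dV (fun p => complex.Re (F p) * complex.Im (lambda * z p) +
      complex.Im (F p) * complex.Re (lambda * z p))).
  by apply: eq_vint => p; exact: Im_mulc.
rewrite (vintD M_closed dVE (cM _ _ k1 lz2) (cM _ _ k2 lz1)) E12 E21.
transitivity (- vint dV (fun p => dot_grad g (fun q => complex.Im (F q)) f1 p +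
    dot_grad g (fun q => complex.Re (F q)) f2 p)); last by [].
rewrite (vintD M_closed dVE (dot_grad_continuous (g := g) F2 f1C)
  (dot_grad_continuous (g := g) F1 f2C)).
by rewrite opprD; exact: addrC.
Qed.

(* The integrals of f^j (conj f)^k, and of the same times kappa(f, conj f). *)
Definition mom j k : C := vintC (fun p => z p ^+ j * w p ^+ k).
Definition momQ j k : C := vintC (fun p => z p ^+ j * w p ^+ k * grad_sq p).

Let zwC j k : C1C (A := A) (fun p => z p ^+ j * w p ^+ k) := C1CM (C1CX j zC)
  (C1CX k wC).

Let zwc j k : contC (fun p => z p ^+ j * w p ^+ k) := C1C_cont (zwC j k).

Let qc : contC grad_sq.
Proof.
split=> p /=; last exact: cst_continuous.
by apply: (@continuousD R R M (dot_grad g f1 f1) (dot_grad g f2 f2));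
  [exact: dot_grad_continuous f1C f1C p|exact: dot_grad_continuous f2C f2C p].
Qed.

Let zwqc j k : contC (fun p => z p ^+ j * w p ^+ k * grad_sq p) := contCM (zwc j k)
  qc.

Lemma contC_cst (c : C) : contC (fun _ : M => c).
Proof. exact: C1C_cont (C1C_cst (A := A) c). Qed.

(* Green's identity with the test function f^j (conj f)^k, using
   kappa(f, f) = mu f^2. *)
Lemma mom_rec j k : (lambda + j%:R * mu) * mom j.+1 k = - (k%:R * momQ j k.-1).
Proof.
have := green_identityC (zwC j k).
rewrite (@eq_vintC _ _ _ _ (fun p => z p ^+ j.+1 * w p ^+ k)); last first.
  by move=> p; rewrite mulrAC -exprSr.
rewrite -/(mom _ _) (@eq_vintC _ _ _ (kappa_f _) (fun p =>
   (j%:R * mu) * (z p ^+ j.+1 * w p ^+ k) + k%:R * (z p ^+ j * w p ^+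
     k.-1 * grad_sq p))); last first.
  move=> p; rewrite (kappa_fM g f1 f2 p (C1CX j zC) (C1CX k wC)).
  rewrite (kappa_fX j p zC) (kappa_fX k p wC) kappa_f_z kappa_f_w.
  move: (grad_sq p) (z p) (w p) => q a b.
  by case: j => [|j] /=; rewrite ?exprS; ring.
rewrite (vintCD M_closed dVE); last 2 first.
- exact: contCM (contC_cst _) (zwc _ _).
- exact: contCM (contC_cst _) (zwqc _ _).
rewrite (vintCZ M_closed dVE _ (zwc _ _)) (vintCZ M_closed dVE _ (zwqc _ _)).
rewrite -/(mom _ _) -/(momQ _ _) => E.
by rewrite mulrDl E opprD addrAC addNr add0r.
Qed.

Lemma vintC_conj F : contC F -> vintC (fun p => conjc (F p)) = conjc (vintC F).
Proof.
move=> [F1 F2]; apply: complex_ext => /=.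
  by apply: eq_vint => p; case: (F p).
rewrite -mulN1r -(vintZ M_closed dVE)//.
by apply: eq_vint => p; case: (F p) => a b /=; rewrite mulN1r.
Qed.

Lemma conjcM (a b : C) : conjc (a * b) = conjc a * conjc b.
Proof. exact: rmorphM. Qed.

Lemma conjcXn (a : C) l : conjc (a ^+ l) = conjc a ^+ l.
Proof. exact: rmorphXn. Qed.

Let conj_zw j k p : conjc (z p ^+ j * w p ^+ k) = z p ^+ k * w p ^+ j.
Proof.
have cz : conjc (z p) = w p by [].
have cw : conjc (w p) = z p by rewrite -[LHS]/(_ +i* - - _)%C opprK.
by rewrite conjcM !conjcXn cz cw mulrC.
Qed.

Lemma mom_conj j k : mom k j = conjc (mom j k).
Proof.
by rewrite -(vintC_conj (zwc j k)); apply: eq_vintC => p; exact/esym/conj_zw.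
Qed.

Lemma momQ_conj j k : momQ k j = conjc (momQ j k).
Proof.
rewrite -(vintC_conj (zwqc j k)); apply: eq_vintC => p.
rewrite conjcM; congr (_ * _); first exact/esym/conj_zw.
by rewrite /grad_sq /= oppr0.
Qed.

Lemma mom_rec_conj j k : (conjc lambda + j%:R * conjc mu) * mom k j.+1 =
  - (k%:R * momQ k.-1 j).
Proof.
have := congr1 conjc (mom_rec j k).
have cD (a b : C) : conjc (a + b) = conjc a + conjc b by exact: rmorphD.
have cN (a : C) : conjc (- a) = - conjc a by exact: rmorphN.
by rewrite conjcM cD conjcM cN conjcM !conjc_nat -mom_conj -momQ_conj.
Qed.


Let N p := f1 p ^+ 2 + f2 p ^+ 2.
Let Q p := dot_grad g f1 f1 p + dot_grad g f2 f2 p.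

Let N_ge0 p : 0 <= N p. Proof. by rewrite addr_ge0// sqr_ge0. Qed.
Let Q_ge0 p : 0 <= Q p. Proof. by rewrite addr_ge0// dot_grad_ge0. Qed.

Let NC : C1M (A := A) N.
Proof. exact: (C1MD (C1MM f1C f1C) (C1MM f2C f2C)). Qed.

Let NXc k : continuous (fun p => N p ^+ k).
Proof. exact: continuous_exprn (C1M_continuous NC). Qed.

Let Qc : continuous Q.
Proof.
move=> p; apply: (@continuousD R R M (dot_grad g f1 f1) (dot_grad g f2 f2)).
  exact: dot_grad_continuous f1C f1C p.
exact: dot_grad_continuous f2C f2C p.
Qed.

Let zwE k p : z p ^+ k * w p ^+ k = (N p ^+ k)%:C%C.
Proof.
rewrite -exprMn rmorphXn; congr (_ ^+ _).
by apply: complex_ext; rewrite /N /=; ring.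
Qed.

Lemma vint_eq0 (u : M -> R) : (forall p, u p = 0) -> vint dV u = 0.
Proof. by move=> u0; rewrite /vint integral0_eq// => p _; rewrite u0. Qed.

Lemma mom_diag k : mom k k = (vint dV (fun p => N p ^+ k))%:C%C.
Proof.
apply: complex_ext => /=; first by apply: eq_vint => p; rewrite zwE.
by apply: vint_eq0 => p; rewrite zwE.
Qed.

Lemma momQ_diag k : momQ k k = (vint dV (fun p => N p ^+ k * Q p))%:C%C.
Proof.
have E p : z p ^+ k * w p ^+ k * grad_sq p = (N p ^+ k * Q p)%:C%C.
  by rewrite zwE rmorphM.
apply: complex_ext => /=; first by apply: eq_vint => p; rewrite E.
by apply: vint_eq0 => p; rewrite E.
Qed.

Hypothesis f_nlc : ~ locally_constant z.

(** The integrand is |f|^(2k) >= 0. A zero integral is absurd for k = 0, and for k > 0 forces f = 0,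
    which is locally constant. *)
Lemma mom_diag_neq0 k : mom k k != 0.
Proof.
apply/eqP; rewrite mom_diag => -[N0].
have {}N0 p : N p = 0.
  have := vint_ge0_eq0 M_closed dVE (@NXc k) (fun q => exprn_ge0 k (N_ge0 q)) N0 p.
  by move=> /eqP; rewrite expf_eq0 => /andP[_ /eqP].
apply: f_nlc => p; apply: nearW => q.
have f0 r : f1 r = 0 /\ f2 r = 0.
  by have /eqP := N0 r; rewrite paddr_eq0 ?sqr_ge0// !sqrf_eq0 =>
    /andP[/eqP-> /eqP->].
by have [-> ->] := f0 q; have [-> ->] := f0 p.
Qed.

(* Otherwise |f|^2 grad f = 0 everywhere, so that |f|^2, and then f, is locally
   constant. *)
Lemma momQ_diag_neq0 k : momQ k k != 0.
Proof.
apply/eqP; rewrite momQ_diag => -[NQ0].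
have {}NQ0 p : N p = 0 \/ Q p = 0.
  have NQc : continuous (fun p => N p ^+ k * Q p).
    by move=> q; apply: (@continuousM R M (fun q => N q ^+ k) Q);
      [exact: NXc|exact: Qc].
  have := vint_ge0_eq0 M_closed dVE NQc (fun q => mulr_ge0 (exprn_ge0 k (N_ge0 q))
    (Q_ge0 q)) NQ0 p.
  move=> /eqP; rewrite mulf_eq0 expf_eq0 => /orP[/andP[_ /eqP]|/eqP]; by [left|right].
have Q0 p : Q p = 0 -> dot_grad g f1 f1 p = 0 /\ dot_grad g f2 f2 p = 0.
  by move=> /eqP; rewrite paddr_eq0 ?dot_grad_ge0// => /andP[/eqP-> /eqP->].
(* The gradient of N is 2 f1 grad f1 + 2 f2 grad f2, and at each point either both functions or both
   gradients vanish. *)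
have gN p : dot_grad g N N p = 0.
  have E : dot_grad g N N p = 2 * f1 p * dot_grad g f1 N p + 2 * f2 p * dot_grad g
    f2 N p.
    transitivity (dot_grad g (fun q => f1 q * f1 q + f2 q * f2 q) N p).
      by congr (dot_grad g _ N p); apply/funext => q; rewrite /N !expr2.
    rewrite (dot_gradDl g N p (C1MM f1C f1C) (C1MM f2C f2C))
      (dot_gradMl g N p f1C f1C) (dot_gradMl g N p f2C f2C).
    by move: (dot_grad g f1 N p) (dot_grad g f2 N p) => a b; ring.
  rewrite E; have [N0|/Q0[g1 g2]] := NQ0 p.
    move: N0 => /eqP; rewrite paddr_eq0 ?sqr_ge0// !sqrf_eq0 => /andP[/eqP-> /eqP->].
    by rewrite !mulr0 !mul0r addr0.
  have z0 u v : dot_grad g u u p = 0 -> dot_grad g u v p = 0.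
    move=> /dot_grad_eq0 d0; rewrite /dot_grad inner_grad_dchart ?d0 ?mul0mx ?mxE//.
    exact: chart_atP.
  by rewrite (z0 _ _ g1) (z0 _ _ g2) !mulr0 addr0.
have Nlc p : \forall q \near p, N q = N p.
  by apply: (dot_grad0_locally_constant (g := g) NC); apply: nearW.
apply: f_nlc => p.
have [N0|Np0] := eqVneq (N p) 0.
  apply: filterS (Nlc p) => q; rewrite N0.
  have zero r : N r = 0 -> f1 r = 0 /\ f2 r = 0.
    by move=> /eqP; rewrite paddr_eq0 ?sqr_ge0// !sqrf_eq0 => /andP[/eqP-> /eqP->].
  by move=> /zero[-> ->]; have [-> ->] := zero _ N0.
have Qnear : \forall q \near p, Q q = 0.
  apply: filterS (Nlc p) => q Nq; case: (NQ0 q) => // Nq0.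
  by move: Np0; rewrite -Nq Nq0 eqxx.
have n1 : \forall q \near p, f1 q = f1 p.
  by apply: (dot_grad0_locally_constant (g := g) f1C); apply: filterS Qnear =>
    q /Q0[].
have n2 : \forall q \near p, f2 q = f2 p.
  by apply: (dot_grad0_locally_constant (g := g) f2C); apply: filterS Qnear =>
    q /Q0[].
by apply: filterS (filterI n1 n2) => q [-> ->].
Qed.

(** [mom_rec] and its conjugate at (k, k + 1) have the same right side and contain the same diagonal
    moment, which is nonzero and can be cancelled. The cases k = 0 and k = 1 make lambda and then mu
    real. *)
Let coefE k : lambda + k%:R * mu = conjc lambda + k%:R * conjc mu.
Proof.
apply: (mulIf (mom_diag_neq0 k.+1)).
by rewrite mom_rec mom_rec_conj.
Qed.

Let lambdaE : conjc lambda = lambda.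
Proof. by have := coefE 0%N; rewrite !mul0r !addr0. Qed.

Let muE : conjc mu = mu.
Proof. by have := coefE 1%N; rewrite lambdaE !mul1r => /addrI. Qed.

(** A zero coefficient would make the left side of [mom_rec k k.+1] vanish, and with it
    [momQ k k]. *)
Let coef_neq0 k : lambda + k%:R * mu != 0.
Proof.
apply/eqP => c0; have := mom_rec k k.+1; rewrite c0 mul0r => /esym/eqP.
by rewrite oppr_eq0 mulf_eq0 pnatr_eq0 (negbTE (momQ_diag_neq0 k)).
Qed.

(** If an exponent is 0, the relation has the factor 0 on its right. Otherwise [mom_rec] and its
    conjugate express one and the same moment through one and the same [momQ j k], which is
    eliminated. *)
Lemma mom_offdiag j k : j != k -> mom j k = 0.
Proof.
case: j => [|j]; case: k => [|k] jk //.
- rewrite mom_conj; have := mom_rec k 0; rewrite mul0r oppr0 => /eqP.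
  by rewrite mulf_eq0 (negbTE (coef_neq0 k)) => /eqP ->; rewrite conjc0.
- have := mom_rec j 0; rewrite mul0r oppr0 => /eqP.
  by rewrite mulf_eq0 (negbTE (coef_neq0 j)) => /eqP ->.
have E1 := mom_rec j k.+1; have E2 := mom_rec_conj k j.+1.
rewrite lambdaE muE /= in E1 E2.
(* The combination (j + 1)(lambda + j mu) - (k + 1)(lambda + k mu) factors in this way; [coef_neq0]
   at the index j + k + 1 disposes of the second factor. *)
have E : (j%:R - k%:R) * (lambda + (j + k).+1%:R * mu) * mom j.+1 k.+1 = 0.
  transitivity (j.+1%:R * ((lambda + j%:R * mu) * mom j.+1 k.+1) -
      k.+1%:R * ((lambda + k%:R * mu) * mom j.+1 k.+1)).
    by rewrite -!natr1 natrD; ring.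
  by rewrite E1 E2; ring.
move: E => /eqP; rewrite !mulf_eq0 (negbTE (coef_neq0 _)) orbF subr_eq0 eqr_nat.
by rewrite eqSS in jk; rewrite (negbTE jk) => /eqP.
Qed.

(** Rotation invariance, tested on mixed monomials so that the induction can trade powers of f1 and
    f2 for powers of f and its conjugate. At a = b = 0 the integral is i (j - k) [mom j k], where j
    = k or the moment is zero. *)
Lemma vintC_rot a b j k : vintC (fun p =>
  rotation_term ('i%C : C) (f1 p)%:C%C (f2 p)%:C%C (z p) (w p) a b j k) = 0.
Proof.
have I2 : ('i%C : C) * 'i%C = -1 by rewrite -expr2 sqr_i.
have C2 : 2%:R != 0 :> C by rewrite pnatr_eq0.
have zE p : z p = (f1 p)%:C%C + 'i%C * (f2 p)%:C%C.
  by apply: complex_ext => /=; ring.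
have wE p : w p = (f1 p)%:C%C - 'i%C * (f2 p)%:C%C.
  by apply: complex_ext => /=; ring.
have xC : C1C (A := A) (fun p => (f1 p)%:C%C) := conj f1C (C1M_cst 0).
have yC : C1C (A := A) (fun p => (f2 p)%:C%C) := conj f2C (C1M_cst 0).
have rc c d l m : contC (fun p =>
    rotation_term ('i%C : C) (f1 p)%:C%C (f2 p)%:C%C (z p) (w p) c d l m).
  apply: contCM (zwc l m); apply: C1C_cont.
  apply: C1CD; last exact: (C1CM (C1CM (C1C_cst _) (C1CX _ xC)) (C1CX _ yC)).
  apply: C1CD; first exact: (C1CM (C1CM (C1C_cst _) (C1CX _ xC)) (C1CX _ yC)).
  by apply: C1CN; exact: (C1CM (C1CM (C1C_cst _) (C1CX _ xC)) (C1CX _ yC)).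
elim: a b j k => [|a IHa] b j k; last first.
  rewrite
    (@eq_vintC _ _ _ _ (fun p => 2%:R^-1 * (rotation_term 'i%C (f1 p)%:C%C
    (f2 p)%:C%C (z p) (w p) a b j.+1 k +
    rotation_term 'i%C (f1 p)%:C%C (f2 p)%:C%C (z p) (w p) a b j k.+1))); last first.
    by move=> p; exact: rotation_termSl.
  rewrite (vintCZ M_closed dVE _ (contCD (rc _ _ _ _) (rc _ _ _ _))).
  by rewrite (vintCD M_closed dVE (rc _ _ _ _) (rc _ _ _ _)) !IHa addr0 mulr0.
elim: b j k => [|b IHb] j k; last first.
  rewrite (@eq_vintC _ _ _ _ (fun p => (- 2%:R^-1 * 'i%C) *
    (rotation_term 'i%C (f1 p)%:C%C (f2 p)%:C%C (z p) (w p) 0 b j.+1 k +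
    (-1) * rotation_term 'i%C (f1 p)%:C%C (f2 p)%:C%C (z p) (w p) 0 b j k.+1)));
      last first.
    by move=> p; rewrite mulN1r; exact: rotation_termSr.
  have rN := contCM (contC_cst (-1)) (rc 0 b j k.+1).
  rewrite (vintCZ M_closed dVE _ (contCD (rc _ _ _ _) rN))
    (vintCD M_closed dVE (rc _ _ _ _) rN).
  by rewrite (vintCZ M_closed dVE _ (rc _ _ _ _)) !IHb mulr0 addr0 mulr0.
rewrite (@eq_vintC _ _ _ _ (fun p => ('i%C * (j%:R - k%:R)) * (z p ^+ j * w p ^+
  k))); last first.
  by move=> p; rewrite /rotation_term !mul0r subr0 add0r !expr0 !mulr1.
rewrite (vintCZ M_closed dVE _ (zwc j k)) -/(mom j k).
have [->|jk] := eqVneq j k; first by rewrite subrr mulr0 mul0r.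
by rewrite mom_offdiag// mulr0.
Qed.

Lemma moment_continuous c d : continuous (fun p => f1 p ^+ c * f2 p ^+ d).
Proof.
move=> p; apply: (@continuousM R M (fun p => f1 p ^+ c) (fun p => f2 p ^+ d)).
  exact: continuous_exprn (C1M_continuous f1C) p.
exact: continuous_exprn (C1M_continuous f2C) p.
Qed.

(** The case j = k = 0 of [vintC_rot], whose integrand is real. *)
Lemma vint_moment_rec a b :
  b%:R * vint dV (fun p => f1 p ^+ a.+1 * f2 p ^+ b.-1) =
  a%:R * vint dV (fun p => f1 p ^+ a.-1 * f2 p ^+ b.+1).
Proof.
have mc := moment_continuous.
have := congr1 (@complex.Re R) (vintC_rot a b 0 0) => /= E.
apply/eqP; rewrite -subr_eq0; apply/eqP; rewrite -[RHS]E.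
rewrite -!(vintZ M_closed dVE)//.
have cZ (r : R) (u : M -> R) : continuous u -> continuous (fun p => r * u p).
  by move=> uc p; apply: (@continuousM R); [exact: cst_continuous|exact: uc].
rewrite -(vintB M_closed dVE); [|exact: cZ|exact: cZ].
apply: eq_vint => p; rewrite /rotation_term subrr mulr0 !mul0r addr0 !expr0 !mulr1.
by rewrite -!rmorphXn -!(rmorph_nat (real_complex R)) -!rmorphM -rmorphB /= !mulrA.
Qed.

End eigenfunction_moments.

Theorem theorem7 (R : realType) (n : nat) (M : ptopologicalType)
  (A : smooth_atlas R n M) (g : riemannian_metric A)
  (M_closed : closed_manifold M)
  (dV : {measure set (borel M) -> \bar R}) (dVE : riemannian_volume g dV)
  (lambda mu : R[i]) (f1 f2 : M -> R)
  (f_eigen : eigenfunction g lambda mu (fun p => (f1 p +i* f2 p)%C))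
  (f_nontriv : (forall p, f1 p = 0 /\ f2 p = 0) \/
               ~ locally_constant (fun p => (f1 p +i* f2 p)%C)) :
  (forall a b : nat, ~ (~~ odd a /\ ~~ odd b) ->
     (\int[dV]_p (f1 p ^+ a * f2 p ^+ b)%:E = 0)%E) /\
  (forall a b : nat,
     (\int[dV]_p (f1 p ^+ (2 * a) * f2 p ^+ (2 * b))%:E =
      ('C(a + b, a)%:R / 'C(2 * a + 2 * b, 2 * a)%:R)%:E *
      \int[dV]_p (f1 p ^+ (2 * a + 2 * b))%:E)%E).
Proof.
case: f_nontriv => [f0|f_nlc].
  have z0 c d p : (0 < c + d)%N -> f1 p ^+ c * f2 p ^+ d = 0.
    by move=> cd; have [-> ->] := f0 p; rewrite -exprD expr0n gtn_eqF.
  split=> a b.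
    move=> ab; rewrite integral0_eq// => p _; rewrite z0//.
    by case: a ab => [|a]; case: b => [|b] // [].
  (* For a = b = 0 both integrands are 0^0 = 1 and the quotient of binomials is 1; for all other
     exponents both integrands vanish. *)
  have [ab|ab] := posnP (a + b)%N.
    have [-> ->] : a = 0%N /\ b = 0%N by lia.
    rewrite !muln0 !bin0 divff ?oner_neq0// mul1e.
    by apply: eq_integral => p _; rewrite mulr1.
  have e1 p : f1 p ^+ (2 * a) * f2 p ^+ (2 * b) = 0 by apply: z0; lia.
  have e2 p : f1 p ^+ (2 * a + 2 * b) = 0.
    by have := z0 (2 * a + 2 * b)%N 0%N p; rewrite expr0 mulr1; apply; lia.
  by rewrite !integral0_eq ?mule0// => p _; rewrite ?e1 ?e2.
have mc := moment_continuous f_eigen.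
have mE := vint_moment_rec M_closed dVE f_eigen f_nlc.
split=> a b.
  move=> ab; rewrite (vintE M_closed dVE (mc a b)); congr EFin.
  exact: (moment_odd (m := fun a b => vint dV (fun p => f1 p ^+ a * f2 p ^+ b)) mE
    ab).
rewrite (vintE M_closed dVE (mc (2 * a)%N (2 * b)%N)).
rewrite (moment_even (m := fun a b => vint dV (fun p => f1 p ^+ a * f2 p ^+ b)) mE a
  b).
rewrite EFinM -(vintE M_closed dVE (mc _ 0%N)); congr (_ * _)%E.
by apply: eq_integral => p _; rewrite expr0 mulr1.
Qed.
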